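(* For every integer $d\ge 2$, $p_d\le 0.4155$, where $p_d=\inf\{p\in[0,1]: \mathrm{FM}(d,p)\text{ is recurrent}\}$ is the critical drift of the one-per-site frog model with drift on the rooted $d$-ary tree.
   Context: $\mathbb T_d$ is the rooted $d$-ary tree: the infinite tree in which every vertex has exactly $d$ children, with root $\varnothing$. The one-per-site frog model with drift $\mathrm{FM}(d,p)$, $p\in[0,1]$: initially there is one awake frog at the root and one sleeping frog at each non-root vertex of $\mathbb T_d$. At each time step every awake frog, independently, moves as follows: from a non-root vertex it moves to the parent vertex (towards the root) with probability $p$, and otherwise (with probability $1-p$) moves to a uniformly sampled child vertex; from the root it always moves to a uniformly sampled child. Sleeping frogs do not move. Whenever an awake frog visits a site with a sleeping frog, that sleeping frog wakes up and begins its own independent $p$-biased random walk of the same kind. $V(d,p)$ is the total number of visits to the root by awake frogs. $\mathrm{FM}(d,p)$ is recurrent if $V(d,p)=\infty$ almost surely. *)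

(* Defs.v *)
From mathcomp Require Import all_boot all_order all_algebra finmap.
From mathcomp Require Import all_classical all_reals all_analysis.

Set Implicit Arguments.
Unset Strict Implicit.
Unset Printing Implicit Defensive.

Import Order.TTheory GRing.Theory Num.Theory.

Local Open Scope classical_set_scope.
Local Open Scope ring_scope.

(* A vertex of the rooted d-ary tree is the word of child indices leading to
   it from the root, most recent index first. *)
Definition vertex (d : nat) : Type := seq 'I_d.

Definition root_vertex (d : nat) : vertex d := [::].

Definition child (d : nat) (x : vertex d) (i : 'I_d) : vertex d := i :: x.

(* On the root this returns the root; [up_prob] vanishes there. *)
Definition parent (d : nat) (x : vertex d) : vertex d := behead x.

Section Walk.
Context (R : realType) (d : nat) (p : R).

Definition up_prob (x : vertex d) : R :=
  if x == root_vertex d then 0 else p.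

Definition trans_prob (x y : vertex d) : R :=
  up_prob x * (y == parent x)%:R
  + \sum_(i < d) (1 - up_prob x) / d%:R * (y == child x i)%:R.

Context (disp : measure_display) (Omega : measurableType disp)
        (P : probability Omega R).

(* The p-biased walk started at [v] is the Markov chain with initial law the
   Dirac mass at [v] and transition matrix [trans_prob]; vertices carry the
   discrete sigma-algebra. *)
Definition biased_walk (v : vertex d) (X : nat -> Omega -> vertex d) : Prop :=
  (forall n (A : set (vertex d)), measurable (X n @^-1` A)) /\
  (forall n (g : nat -> vertex d),
     P [set w | forall k, (k <= n)%N -> X k w = g k] =
     ((g 0%N == v)%:R * \prod_(k < n) trans_prob (g k) (g k.+1))%:E).

Definition process_events (X : nat -> Omega -> vertex d) : set (set Omega) :=
  <<s [set B | exists n (A : set (vertex d)), B = X n @^-1` A] >>.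

Definition independent_processes (I : choiceType)
    (X : I -> nat -> Omega -> vertex d) : Prop :=
  forall (J : {fset I}) (A : I -> set Omega),
    (forall i, i \in J -> process_events (X i) (A i)) ->
    P (\bigcap_(i in [set` J]) A i) = (\prod_(i <- J) P (A i))%E.

(* [X v] is the walk attached to the frog initially at [v]: [X v n] is the
   position of this frog once it has made [n] steps. *)
Definition frog_walks (X : vertex d -> nat -> Omega -> vertex d) : Prop :=
  (forall v, biased_walk v (X v)) /\ independent_processes X.

End Walk.

Section Dynamics.
Context (d : nat) (X : vertex d -> nat -> vertex d).

(* [steps t v] is [None] when the frog initially at [v] still sleeps at time
   [t], and [Some n] when it is awake and has made [n] steps. *)
Fixpoint steps (t : nat) (v : vertex d) : option nat :=
  match t with
  | 0 => if v == root_vertex d then Some 0%N else None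
  | t'.+1 =>
    if steps t' v is Some n then Some n.+1
    else if `[< exists u n, steps t' u = Some n /\ X u n.+1 = v >]
         then Some 0%N else None
  end.

Definition awake_at (t : nat) (v x : vertex d) : Prop :=
  exists n, steps t v = Some n /\ X v n = x.

(* Pairs (time, frog), so that simultaneous visits count separately. The
   initial position of the first frog counts as a visit, which does not affect
   whether the total is infinite. *)
Definition root_visits : set (nat * vertex d) :=
  [set tv | awake_at tv.1 tv.2 (root_vertex d)].

Definition num_root_visits (R : realType) : \bar R := counting root_visits.

End Dynamics.

(* The law of the walks is determined by [d] and [p], so that the choice of the
   underlying probability space and of the walks is immaterial. *)
Definition frog_recurrent (R : realType) (d : nat) (p : R) : Prop :=
  forall (disp : measure_display) (Omega : measurableType disp)
    (P : probability Omega R) (X : vertex d -> nat -> Omega -> vertex d),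
    frog_walks p P X ->
    {ae P, forall w, num_root_visits (fun v n => X v n w) R = +oo%E}.

(* An infimum in the extended reals, hence +oo (and not 0) on the empty set. *)
Definition critical_drift (R : realType) (d : nat) : \bar R :=
  ereal_inf [set p%:E | p in [set p : R | 0 <= p <= 1 /\ frog_recurrent d p]].

(* Main.v *)
Require Import Defs.
From mathcomp Require Import all_boot all_order all_algebra finmap.
From mathcomp Require Import all_classical all_reals all_analysis.
From mathcomp Require Import ring lra zify.

Set Implicit Arguments.
Unset Strict Implicit.
Unset Printing Implicit Defensive.

Import Order.TTheory GRing.Theory Num.Theory.
Import numFieldNormedType.Exports.

Local Open Scope classical_set_scope.
Local Open Scope ring_scope.

(** The times at which frogs wake up are irrelevant for recurrence: a frog wakes
up as soon as some awake frog ever visits its vertex. Take [p = 7 / 17], so that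
a walk ever climbs one level with probability [p / (1 - p) = 7 / 10], while it
ever visits a given vertex [k] levels below its start with probability at least
[d ^ - k].

Say that a vertex [y], five levels below an awake vertex [x], is reached if the
five frogs on the path from [x] to [y], excluding [y], wake up one another and
[y]. This has probability at least [31 / 5 * d ^ - 5], so the [d ^ 5] candidates
[y] contribute more than 6 on average, and [6 * (7 / 10) ^ 5 > 1]. Different
blocks of five levels use different, hence independent, frogs, and by Bonferroni's
inequality the probability that some frog [n] blocks below [x] wakes up and visits
the root is eventually (in [n]) at least a constant [c > 0] that does not depend
on [x]. Hence with probability at least [c] infinitely many frogs below [x] visit
the root, once the frog at [x] is awake.

The first frog almost surely visits a whole path of any given length [K]. Along
this path, the frog at each vertex may wake up a sibling of the next vertex, below
which infinitely many frogs then visit the root with probability at least [c].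
These [K] attempts are independent, so they all fail with a probability that tends
to 0 as [K] grows. *)

(** * Independence of generated sigma-algebras *)

Section SigmaClosure.
Context (T : Type) (G : set (set T)).

Lemma gsigma_setC A : <<s G >> A -> <<s G >> (~` A).
Proof. by move=> sA; rewrite -setTD; exact: sigma_algebraCD. Qed.

Lemma gsigma_bigcup (I : countType) (D : set I) (F : I -> set T) :
  (forall i, D i -> <<s G >> (F i)) -> <<s G >> (\bigcup_(i in D) F i).
Proof.
move=> sF.
(* Enumerates [I] by its pickling; a number that codes no index, or an index outside [D],
   contributes the empty set. *)
pose F' n := if @choice.unpickle I n is Some i then
  (if `[< D i >] then F i else set0) else set0.
rewrite (_ : \bigcup_(i in D) F i = \bigcup_n F' n).
  apply: sigma_algebra_bigcup => n; rewrite /F'.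
  case: choice.unpickle => [i|]; last exact: sigma_algebra0.
  by case: asboolP => [/sF//|_]; exact: sigma_algebra0.
apply/seteqP; split => x [i Di Fx].
  by exists (choice.pickle i) => //; rewrite /F' choice.pickleK asboolT.
move: Fx; rewrite /F'; case: choice.unpickle => [j|//].
by case: asboolP => // Dj Fj; exists j.
Qed.

Lemma gsigma_bigcap (I : countType) (D : set I) (F : I -> set T) :
  (forall i, D i -> <<s G >> (F i)) -> <<s G >> (\bigcap_(i in D) F i).
Proof.
move=> sF; rewrite -(setCK (\bigcap_(i in D) F i)) setC_bigcap.
apply: gsigma_setC; apply: gsigma_bigcup => i Di.
by apply: gsigma_setC; exact: sF.
Qed.

Lemma gsigma_setT : <<s G >> setT.
Proof.
have := gsigma_setC (@sigma_algebra0 T setT G); by rewrite setC0.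
Qed.

Lemma gsigma_setU A B : <<s G >> A -> <<s G >> B -> <<s G >> (A `|` B).
Proof.
move=> sA sB; rewrite (_ : A `|` B = \bigcup_(b in [set: bool]) if b then A else B).
  by apply: gsigma_bigcup => -[].
apply/seteqP; split => [x [Ax|Bx]|x [[] _ ?]]; [exists true|exists false|left|right] => //.
Qed.

Lemma gsigma_setI A B : <<s G >> A -> <<s G >> B -> <<s G >> (A `&` B).
Proof.
move=> sA sB; rewrite -(setCK (A `&` B)) setCI.
by apply: gsigma_setC; apply: gsigma_setU; exact: gsigma_setC.
Qed.

End SigmaClosure.

Section Independence.
Context (R : realType) (disp : measure_display) (T : measurableType disp)
        (P : probability T R).

Definition indep_systems (G H : set (set T)) :=
  forall A B, G A -> H B -> P (A `&` B) = (P A * P B)%E.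

Lemma indep_systemsC G H : indep_systems G H -> indep_systems H G.
Proof. by move=> i A B HA GB; rewrite setIC muleC; exact: i. Qed.

(** For fixed [B], both sides are finite measures in [A] that agree on the pi-system [G], which
    contains the whole space; hence they agree on the generated sigma-algebra. *)
Lemma indep_gsigma_l (G H : set (set T)) :
  G `<=` measurable -> H `<=` measurable -> G setT -> setI_closed G ->
  indep_systems G H -> indep_systems <<s G >> H.
Proof.
move=> mG mH GT GI iGH A B sA HB.
have mB := mH _ HB.
have ffin : P B \is a fin_num by exact: fin_num_measure.
have f0 : 0 <= fine (P B) by rewrite fine_ge0.
pose m2 := mscale (NngNum f0) P.
have -> : P (A `&` B) = m2 A.
  apply: (@g_sigma_algebra_measure_unique _ R T G mG (fun=> setT) (fun=> GT) _
    (mrestr P mB) m2 GI) sA => //.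
  - by rewrite bigcup_const.
  - move=> C GC; transitivity ((fine (P B))%:E * P C)%E; last by [].
    by rewrite fineK// muleC; exact: iGH.
  - by move=> _; rewrite /= /mrestr setTI ltey_eq ffin.
transitivity ((fine (P B))%:E * P A)%E; first by [].
by rewrite fineK// muleC.
Qed.

(** The one-sided extension is applied twice, with the two systems exchanged in between. *)
Lemma indep_gsigma (G H : set (set T)) :
  G `<=` measurable -> H `<=` measurable -> G setT -> H setT ->
  setI_closed G -> setI_closed H ->
  indep_systems G H -> indep_systems <<s G >> <<s H >>.
Proof.
move=> mG mH GT HT GI HI iGH.
apply/indep_systemsC/indep_gsigma_l => //.
  exact: smallest_sub (@sigma_algebra_measurable _ T) mG.
exact/indep_systemsC/indep_gsigma_l.
Qed.

End Independence.

(** * Real-valued probabilities *)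

Section RealProbability.
Context (R : realType) (disp : measure_display) (T : measurableType disp)
        (P : probability T R).

(** Real rather than extended real values, so that [ring] and [lra] apply; on measurable sets [P] is
    finite and nothing is lost. *)
Definition pr (A : set T) : R := fine (P A).

Lemma prE A : measurable A -> P A = (pr A)%:E.
Proof. by move=> mA; rewrite fineK// fin_num_measure. Qed.

Lemma pr_ge0 A : 0 <= pr A.
Proof. by rewrite fine_ge0. Qed.

Lemma pr_setT : pr setT = 1.
Proof. by rewrite /pr probability_setT. Qed.

Lemma pr_set0 : pr set0 = 0.
Proof. by rewrite /pr measure0. Qed.

Lemma le_pr A B : measurable A -> measurable B -> A `<=` B -> pr A <= pr B.
Proof.
by move=> mA mB AB; rewrite fine_le ?fin_num_measure// le_measure// inE.
Qed.

Lemma pr_le1 A : measurable A -> pr A <= 1.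
Proof. by move=> mA; rewrite -pr_setT le_pr. Qed.

Lemma pr_setU A B : measurable A -> measurable B -> A `&` B = set0 ->
  pr (A `|` B) = pr A + pr B.
Proof.
by move=> mA mB AB; rewrite /pr measureU// fineD// fin_num_measure.
Qed.

Lemma pr_setC A : measurable A -> pr (~` A) = 1 - pr A.
Proof.
move=> mA; rewrite -pr_setT -(setUv A) pr_setU ?setICr//; first by ring.
exact: measurableC.
Qed.

Lemma pr_split A B : measurable A -> measurable B ->
  pr A = pr (A `&` B) + pr (A `\` B).
Proof.
move=> mA mB; rewrite -pr_setU; last first.
- by rewrite setDE setIACA setICr setI0.
- exact: measurableD.
- exact: measurableI.
- by rewrite setUIDK.
Qed.

Lemma pr_setD A B : measurable A -> measurable B -> B `<=` A ->
  pr (A `\` B) = pr A - pr B.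
Proof. by move=> mA mB BA; rewrite (pr_split mA mB) setIidr//; ring. Qed.

Lemma pr_setUI A B : measurable A -> measurable B ->
  pr (A `|` B) = pr A + pr B - pr (A `&` B).
Proof.
move=> mA mB; rewrite (pr_split (measurableU _ _ mA mB) mB).
rewrite setIC setIUr setIid setDUl setDv setU0 (pr_split mA mB).
rewrite (setIC B A) (setUidr (@subIsetr _ A B)); ring.
Qed.

Lemma pr_setU_le A B : measurable A -> measurable B ->
  pr (A `|` B) <= pr A + pr B.
Proof. by move=> mA mB; rewrite pr_setUI// lerBlDr lerDl pr_ge0. Qed.

Lemma pr_indep A B : measurable A -> measurable B ->
  P (A `&` B) = (P A * P B)%E -> pr (A `&` B) = pr A * pr B.
Proof.
by move=> mA mB PAB; rewrite /pr PAB fineM// fin_num_measure.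
Qed.

End RealProbability.

(** * Independence of disjoint families of frogs *)

Section FrogSigma.
Context (R : realType) (d : nat) (disp : measure_display)
        (T : measurableType disp) (P : probability T R)
        (X : vertex d -> nat -> T -> vertex d).
Hypothesis mX : forall v n (A : set (vertex d)), measurable (X v n @^-1` A).
Hypothesis iX : independent_processes P X.

Definition frog_sigma (J : set (vertex d)) : set (set T) :=
  <<s [set B | exists2 v, J v & process_events (X v) B] >>.

Lemma frog_sigmaS J K : J `<=` K -> frog_sigma J `<=` frog_sigma K.
Proof.
by move=> JK; apply: sub_sigma_algebra2 => B [v Jv vB]; exists v => //; exact: JK.
Qed.

Lemma frog_sigma_process J v B : J v -> process_events (X v) B -> frog_sigma J B.
Proof. by move=> Jv vB; apply: sub_sigma_algebra; exists v. Qed.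

Lemma measurable_process v B : process_events (X v) B -> measurable B.
Proof.
apply: smallest_sub; first exact: sigma_algebra_measurable.
by move=> _ [n [A ->]].
Qed.

Lemma measurable_frog_sigma J B : frog_sigma J B -> measurable B.
Proof.
apply: smallest_sub; first exact: sigma_algebra_measurable.
by move=> C [v _]; exact: measurable_process.
Qed.

(* A pi-system generating [frog_sigma J]. *)
Definition frog_cylinders (J : set (vertex d)) : set (set T) :=
  [set C | exists (F : {fset vertex d}) (A : vertex d -> set T),
    [/\ forall v, v \in F -> J v, forall v, process_events (X v) (A v),
        forall v, v \notin F -> A v = setT &
        C = \bigcap_(v in [set` F]) A v]].

Lemma process_setT v : process_events (X v) setT.
Proof. exact: gsigma_setT. Qed.

Lemma frog_cylindersT J : frog_cylinders J setT.
Proof.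
exists fset0, (fun=> setT); split => // [v|]; first exact: process_setT.
by rewrite bigcapT.
Qed.

Lemma frog_cylinders_measurable J : frog_cylinders J `<=` measurable.
Proof.
move=> _ [F [A [_ pA _ ->]]]; apply: fin_bigcap_measurable => // v _.
exact: measurable_process (pA v).
Qed.

(** Lets two cylinders be written over a common finite index set, each padded with [setT]. *)
Lemma bigcap_fset_total (F K : {fset vertex d}) (A : vertex d -> set T) :
  (forall v, v \notin F -> A v = setT) -> (F `<=` K)%fset ->
  \bigcap_(v in [set` K]) A v = \bigcap_(v in [set` F]) A v.
Proof.
move=> AT FK; apply/seteqP; split => x xA v /= vK.
  by apply: xA; exact: (fsubsetP FK).
by have [/xA//|/AT->//] := boolP (v \in F).
Qed.

Lemma frog_cylindersI J : setI_closed (frog_cylinders J).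
Proof.
move=> _ _ [F [A [FJ pA AT ->]]] [K [B [KJ pB BT ->]]].
exists (F `|` K)%fset, (fun v => A v `&` B v); split.
- by move=> v /fsetUP[/FJ|/KJ].
- by move=> v; apply: gsigma_setI; [exact: pA|exact: pB].
- by move=> v; rewrite inE negb_or => /andP[/AT-> /BT->]; rewrite setIT.
rewrite bigcapI -(bigcap_fset_total AT (fsubsetUl F K)).
by rewrite -(bigcap_fset_total BT (fsubsetUr F K)).
Qed.

Lemma frog_sigma_cylinders J : frog_sigma J `<=` <<s frog_cylinders J >>.
Proof.
apply: sub_sigma_algebra2 => B [v Jv vB].
exists [fset v]%fset, (fun u => if u == v then B else setT); split.
- by move=> u /fset1P->.
- by move=> u; case: eqP => [->//|_]; exact: process_setT.
- by move=> u; rewrite inE => /negbTE->.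
- apply/seteqP; split => [x Bx u /= /fset1P->|x /(_ v)]; first by rewrite eqxx.
  by rewrite /= eqxx; apply; rewrite inE.
Qed.

(** Over the union of the two index sets the product formula for the walks applies. By disjointness
    each frog carries a constraint from one side only, so the product splits. *)
Lemma frog_cylinders_indep J K : J `&` K = set0 ->
  indep_systems P (frog_cylinders J) (frog_cylinders K).
Proof.
move=> JK _ _ [F [A [FJ pA AT ->]]] [G [B [GK pB BT ->]]].
have FG0 : [disjoint F & G]%fset.
  apply/fdisjointP => v /FJ Jv; apply/negP => /GK Kv.
  by have : (J `&` K) v by []; rewrite JK.
rewrite -(bigcap_fset_total AT (fsubsetUl F G)).
rewrite -(bigcap_fset_total BT (fsubsetUr F G)) -bigcapI.
rewrite (iX (J := (F `|` G)%fset)); last first.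
  by move=> v _; apply: gsigma_setI; [exact: pA|exact: pB].
rewrite (bigcap_fset_total AT (fsubsetUl F G)) (bigcap_fset_total BT (fsubsetUr F G)).
rewrite !iX; [|by move=> v _; exact: pB|by move=> v _; exact: pA].
have FGp : perm_eq (F `|` G)%fset (enum_fset F ++ enum_fset G).
  apply: uniq_perm; rewrite ?fset_uniq// ?cat_uniq ?fset_uniq ?andbT/=.
    rewrite -all_predC; apply/allP => v /= vG; apply/negP => vF.
    by move/fdisjointP : FG0 => /(_ v vF); rewrite vG.
  by move=> v; rewrite inE mem_cat.
rewrite (perm_big _ FGp) big_cat/=; congr (_ * _)%E; rewrite big_seq [RHS]big_seq.
  apply: eq_bigr => v vF; rewrite BT ?setIT//.
  by apply: contraL vF => vG; move/fdisjointP : FG0 => /(_ v) /contraL; apply.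
apply: eq_bigr => v vG; rewrite AT ?setTI//.
by move/fdisjointP : FG0 => /(_ v) /contraL; apply.
Qed.

(** The form in which independence is used from here on: it extends from cylinders to the
    sigma-algebras that they generate. *)
Lemma frog_sigma_indep J K A B : J `&` K = set0 ->
  frog_sigma J A -> frog_sigma K B -> pr P (A `&` B) = pr P A * pr P B.
Proof.
move=> JK sA sB; apply: pr_indep.
- exact: measurable_frog_sigma sA.
- exact: measurable_frog_sigma sB.
have := @indep_gsigma R _ T P (frog_cylinders J) (frog_cylinders K).
apply; do ?[exact: frog_cylinders_measurable|exact: frog_cylindersT|
  exact: frog_cylindersI|exact: frog_sigma_cylinders].
exact: frog_cylinders_indep.
Qed.

End FrogSigma.

(** * Hitting probabilities of the biased walk *)

(** The sets [F i] are removed from [A] one by one; disjointness keeps the others inside what is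
    left. *)
Lemma pr_sum_le (R : realType) (disp : measure_display)
    (T : measurableType disp) (P : probability T R) (I : eqType) (r : seq I)
    (F : I -> set T) (A : set T) :
  uniq r -> measurable A -> (forall i, measurable (F i)) ->
  (forall i, i \in r -> F i `<=` A) ->
  (forall i j, i != j -> F i `&` F j = set0) ->
  \sum_(i <- r) pr P (F i) <= pr P A.
Proof.
move=> ur mA mF FA dF.
elim: r ur A mA FA => [_ A _ _|i r IHr /= /andP[ir ur] A mA FA].
  by rewrite big_nil pr_ge0.
rewrite big_cons (pr_split P mA (mF i)) setIC setIidl; last first.
  by apply: FA; rewrite mem_head.
rewrite lerD2l; apply: IHr => //; first exact: measurableD.
move=> j jr x Fjx; split; first by apply: (FA j) => //; rewrite inE jr orbT.
move=> Fix; have ij : i != j by apply: contraNneq ir => ->.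
by have : (F i `&` F j) x by []; rewrite dF.
Qed.

(** [None] is the move upwards. At the root it stays put, with weight 0 in [wt], so that distinct
    moves lead to distinct vertices everywhere. *)
Definition mv d (x : vertex d) (m : option 'I_d) : vertex d :=
  if m is Some i then child x i else parent x.

Lemma mv_inj d (x : vertex d) : injective (mv x).
Proof.
have cN i : mv x (Some i) != mv x None.
  apply/negP => /eqP /(congr1 size) /=; rewrite size_behead; lia.
move=> [i|] [j|] //= e; first by case: e => ->.
- by have := cN i; rewrite /= e eqxx.
- by have := cN j; rewrite /= e eqxx.
Qed.

Section Moves.
Context (R : realType) (d : nat) (p : R).
Hypothesis d0 : (0 < d)%N.

Definition wt (x : vertex d) (m : option 'I_d) : R :=
  if m is Some i then (1 - up_prob p x) / d%:R else up_prob p x.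

Definition moves : seq (option 'I_d) := None :: [seq Some i | i <- enum 'I_d].

Lemma moves_uniq : uniq moves.
Proof.
rewrite /moves /= map_inj_uniq ?enum_uniq ?andbT; last by move=> i j [].
by apply/mapP => -[].
Qed.

Lemma sum_moves (F : option 'I_d -> R) :
  \sum_(m <- moves) F m = F None + \sum_(i < d) F (Some i).
Proof. by rewrite /moves big_cons big_map big_enum. Qed.

Lemma sum_wt (F : vertex d -> R) x :
  \sum_(m <- moves) wt x m * F (mv x m) =
  up_prob p x * F (parent x)
  + (1 - up_prob p x) / d%:R * \sum_(i < d) F (child x i).
Proof. by rewrite sum_moves /= mulr_sumr. Qed.

Lemma dR0 : d%:R != 0 :> R.
Proof. by rewrite pnatr_eq0 -lt0n. Qed.

Lemma sum_wt1 x : \sum_(m <- moves) wt x m = 1.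
Proof.
rewrite sum_moves /= sumr_const card_ord -[X in _ + X]mulr_natr.
by rewrite divfK ?dR0//; ring.
Qed.

Lemma trans_mv x m : trans_prob p x (mv x m) = wt x m.
Proof.
rewrite /trans_prob; case: m => [i|] /=.
  have /negbTE-> : child x i != parent x.
    by have := @mv_inj _ x (Some i) None; case: eqP => // e /(_ e).
  rewrite mulr0 add0r (bigD1 i)//= eqxx mulr1 big1 ?addr0// => j ji.
  case: eqP => [[/esym/eqP ji']|]; last by rewrite mulr0.
  by rewrite ji' in ji.
rewrite eqxx mulr1 big1 ?addr0// => i _.
case: eqP => [e|]; last by rewrite mulr0.
by have := @mv_inj _ x None (Some i) e.
Qed.

End Moves.

Section HittingProbability.
Context (R : realType) (d : nat) (p : R).
Hypothesis d0 : (0 < d)%N.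
Hypothesis p01 : 0 <= p <= 1.

Lemma wt_ge0 (x : vertex d) m : 0 <= wt p x m.
Proof.
move/andP: p01 => [p0 p1].
rewrite /wt /up_prob; case: m => [i|]; case: eqP => // _;
by rewrite divr_ge0// subr_ge0.
Qed.

(** First-step recursion for the probability of visiting [B] at one of the times 0 to [n]. *)
Fixpoint hitn (B : pred (vertex d)) (n : nat) (x : vertex d) : R :=
  if n is n'.+1 then
    if B x then 1 else \sum_(m <- moves d) wt p x m * hitn B n' (mv x m)
  else (B x)%:R.

(* The supermartingale error term [C * lam ^+ n * s ^+ size x] absorbs the walks
   that are still wandering at time [n]. *)
Lemma hitn_lower (B : pred (vertex d)) (g : vertex d -> R) (C s lam : R) :
  0 <= C -> 0 <= s -> 0 <= lam ->
  (forall x, B x -> g x <= 1) ->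
  (forall x, ~~ B x -> g x <= \sum_(m <- moves d) wt p x m * g (mv x m)) ->
  (forall x, ~~ B x -> g x <= C * s ^+ size x) ->
  (forall x : vertex d,
     \sum_(m <- moves d) wt p x m * s ^+ size (mv x m) <= lam * s ^+ size x) ->
  forall n x, g x - C * lam ^+ n * s ^+ size x <= hitn B n x.
Proof.
move=> C0 s0 l0 gB gsub gC slam; elim=> [|n IHn] x /=.
  have [Bx|Bx] := boolP (B x); last by rewrite expr0 mulr1 subr_le0 gC.
  by rewrite lerBlDr (le_trans (gB _ Bx))// lerDl !mulr_ge0 ?exprn_ge0.
have [Bx|Bx] := boolP (B x).
  by rewrite lerBlDr (le_trans (gB _ Bx))// lerDl !mulr_ge0 ?exprn_ge0.
apply: (@le_trans _ _ (\sum_(m <- moves d)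
    wt p x m * (g (mv x m) - C * lam ^+ n * s ^+ size (mv x m)))); last first.
  by apply: ler_sum => m _; rewrite ler_wpM2l ?wt_ge0.
under eq_bigr do rewrite mulrBr mulrCA.
rewrite sumrB -mulr_sumr lerB ?gsub//.
by rewrite exprSr (mulrA C) -(mulrA _ lam) ler_wpM2l// mulr_ge0// exprn_ge0.
Qed.

Context (disp : measure_display) (T : measurableType disp) (P : probability T R).
Context (v : vertex d) (X : nat -> T -> vertex d).
Hypothesis bX : biased_walk p P v X.

Definition cyl (g : nat -> vertex d) (n : nat) : set T :=
  [set w | forall k, (k <= n)%N -> X k w = g k].

Definition ext (g : nat -> vertex d) (n : nat) (y : vertex d) : nat -> vertex d :=
  fun k => if (k <= n)%N then g k else y.

Lemma measurable_walk n (A : set (vertex d)) : measurable (X n @^-1` A).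
Proof. by case: bX. Qed.

Lemma measurable_cyl g n : measurable (cyl g n).
Proof.
rewrite (_ : cyl g n = \bigcap_(k in [set k | (k <= n)%N]) (X k @^-1` [set g k])).
  apply: bigcap_measurable; first by exists 0%N.
  by move=> k _; exact: measurable_walk.
by apply/seteqP; split => w h k /= kn; exact: h.
Qed.

Lemma pr_cyl g n : pr P (cyl g n) =
  (g 0%N == v)%:R * \prod_(k < n) trans_prob p (g k) (g k.+1).
Proof. by case: bX => _ /(_ n g); rewrite /pr /cyl => ->. Qed.

Lemma pr_cyl_ext g n m :
  pr P (cyl (ext g n (mv (g n) m)) n.+1) = pr P (cyl g n) * wt p (g n) m.
Proof.
rewrite !pr_cyl big_ord_recr /= {1}/ext leq0n mulrA; congr (_ * _ * _).
  by apply: eq_bigr => k _; rewrite /ext (ltnW (ltn_ord k)) ltn_ord.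
by rewrite /ext leqnn ltnn trans_mv.
Qed.

(** The Markov step of the two inductions below: the one-move extensions of a cylinder are disjoint
    events inside it, weighted by [wt], so lower bounds valid after each move average to a lower
    bound before it. *)
Lemma pr_cyl_step g n (E : set T) (F : option 'I_d -> set T)
    (h : option 'I_d -> R) :
  measurable E -> (forall m, measurable (F m)) ->
  (forall m, cyl (ext g n (mv (g n) m)) n.+1 `&` F m `<=` E) ->
  (forall m, pr P (cyl (ext g n (mv (g n) m)) n.+1) * h m <=
     pr P (cyl (ext g n (mv (g n) m)) n.+1 `&` F m)) ->
  pr P (cyl g n) * (\sum_(m <- moves d) wt p (g n) m * h m) <= pr P (cyl g n `&` E).
Proof.
move=> mE mF FE hF; pose D m := cyl (ext g n (mv (g n) m)) n.+1.
apply: (@le_trans _ _ (\sum_(m <- moves d) pr P (D m `&` F m))).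
  rewrite mulr_sumr; apply: ler_sum => m _.
  by rewrite mulrA -pr_cyl_ext hF.
apply: pr_sum_le => //.
- exact: moves_uniq.
- by apply: measurableI => //; exact: measurable_cyl.
- by move=> m; apply: measurableI => //; exact: measurable_cyl.
- move=> m _ w DFw; split; last exact: FE DFw.
  by move=> k kn; have [/(_ k (leqW kn)) -> _] := DFw; rewrite /ext kn.
- move=> i j ij; apply/seteqP; split => // w [[Di _] [Dj _]].
  case/eqP: ij; apply: (@mv_inj _ (g n)).
  have := Di n.+1 (leqnn _); have := Dj n.+1 (leqnn _).
  by rewrite /ext ltnn => -> ->.
Qed.

Definition moves_legally (k n : nat) : set T :=
  [set w | forall j, (k <= j < k + n)%N -> exists m, X j.+1 w = mv (X j w) m].

Lemma measurable_legal_step j :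
  measurable [set w | exists m, X j.+1 w = mv (X j w) m].
Proof.
rewrite (_ : [set w | _] = \bigcup_(x in [set: vertex d])
   \bigcup_(m in [set: option 'I_d]) (X j @^-1` [set x] `&` X j.+1 @^-1` [set mv x m])).
  apply: countable_bigcupT_measurable => [|x]; first exact: countableP.
  apply: countable_bigcupT_measurable => [|m]; first exact: countableP.
  by apply: measurableI; exact: measurable_walk.
apply/seteqP; split => w; first by move=> [m e]; exists (X j w) => //; exists m.
by move=> [x _ [m _ [/= -> ->]]]; exists m.
Qed.

Lemma measurable_moves_legally k n : measurable (moves_legally k n).
Proof.
rewrite (_ : moves_legally k n = \bigcap_(j in [set j | (k <= j < k + n)%N])
   [set w | exists m, X j.+1 w = mv (X j w) m]).
  apply: bigcap_measurableType => j _; exact: measurable_legal_step.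
by apply/seteqP; split.
Qed.

(** The weights of the moves sum to 1, so extending a cylinder by moves along edges loses no
    mass. *)
Lemma pr_moves_legally g k n :
  pr P (cyl g k) <= pr P (cyl g k `&` moves_legally k n).
Proof.
elim: n g k => [|n IHn] g k.
  rewrite setIidl// => w _ j; lia.
rewrite -[leLHS]mulr1 -(sum_wt1 p d0 (g k)).
under eq_bigr do rewrite -[wt _ _ _]mulr1.
apply: (pr_cyl_step (F := fun=> moves_legally k.+1 n)).
- exact: measurable_moves_legally.
- by move=> _; exact: measurable_moves_legally.
- move=> m w [gw lw] j jkn; have [->|kj] := eqVneq j k; last by apply: lw; lia.
  by exists m; rewrite !gw// /ext leqnn ltnn.
- by move=> m; rewrite mulr1 IHn.
Qed.

Definition visits (B : pred (vertex d)) (k n : nat) : set T :=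
  [set w | exists2 j, (k <= j <= k + n)%N & B (X j w)].

Lemma measurable_visits B k n : measurable (visits B k n).
Proof.
rewrite (_ : visits B k n = \bigcup_(j in [set j | (k <= j <= k + n)%N])
   X j @^-1` [set x | B x]); last by apply/seteqP; split.
by apply: bigcup_measurable => j _; exact: measurable_walk.
Qed.

Lemma pr_visits B g k n :
  pr P (cyl g k) * hitn B n (g k) <= pr P (cyl g k `&` visits B k n).
Proof.
have hB g' k' n' : B (g' k') ->
    pr P (cyl g' k') <= pr P (cyl g' k' `&` visits B k' n').
  move=> Bg; rewrite setIidl// => w gw; exists k'; first lia.
  by rewrite gw.
elim: n g k => [|n IHn] g k /=.
  by have [/hB|_] := boolP (B (g k)); rewrite ?mulr1// mulr0 pr_ge0.
case: ifPn => [/hB|_]; first by rewrite mulr1.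
apply: (pr_cyl_step (F := fun=> visits B k.+1 n)).
- exact: measurable_visits.
- by move=> _; exact: measurable_visits.
- by move=> m w [_ [j jkn Bj]]; exists j => //; lia.
- move=> m; have := IHn (ext g k (mv (g k) m)) k.+1.
  by rewrite {2}/ext ltnn.
Qed.

(** The almost sure event on which deterministic statements about trajectories in the tree apply. *)
Definition proper : set T :=
  [set w | X 0%N w = v /\ forall j, exists m, X j.+1 w = mv (X j w) m].

Lemma properE :
  proper = X 0%N @^-1` [set v] `&`
    \bigcap_(j in [set: nat]) [set w | exists m, X j.+1 w = mv (X j w) m].
Proof.
by apply/seteqP; split => w [w0 wl]; split => // j; [move=> _|]; exact: wl.
Qed.

Lemma measurable_proper : measurable proper.
Proof.
rewrite properE; apply: measurableI; first exact: measurable_walk.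
by apply: bigcap_measurableType => j _; exact: measurable_legal_step.
Qed.

Lemma pr_start : pr P (cyl (fun=> v) 0) = 1.
Proof. by rewrite pr_cyl big_ord0 eqxx mulr1. Qed.

Lemma pr_properC : P (~` proper) = 0%E.
Proof.
apply/(negligibleP P); first exact/measurableC/measurable_proper.
apply: (@negligibleS _ _ _ _
  (\bigcup_n ~` (cyl (fun=> v) 0 `&` moves_legally 0 n))).
  move=> w nw; apply: contrapT => hw; apply: nw.
  have {}hw n : (cyl (fun=> v) 0 `&` moves_legally 0 n) w.
    by apply: contrapT => h; apply: hw; exists n.
  split; first by have [/(_ 0%N)->//] := hw 0%N.
  by move=> j; have [_] := hw j.+1; apply; lia.
apply: negligible_bigcup => n.
have mE : measurable (cyl (fun=> v) 0 `&` moves_legally 0 n).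
  by apply: measurableI; [exact: measurable_cyl|exact: measurable_moves_legally].
apply/(negligibleP P); first exact: measurableC.
apply: (etrans (prE P (measurableC mE))).
congr EFin; rewrite pr_setC//; apply/eqP; rewrite subr_eq0 eq_sym eq_le pr_le1//=.
by rewrite -[leLHS]pr_start pr_moves_legally.
Qed.

Lemma pr_proper_setI A : measurable A -> pr P (proper `&` A) = pr P A.
Proof.
move=> mA; have mp := measurable_proper.
rewrite [RHS](pr_split P mA mp) (setIC A) [X in _ + X](_ : _ = 0) ?addr0//.
apply/eqP; rewrite eq_le pr_ge0 andbT.
have -> : 0 = pr P (~` proper) by rewrite /pr pr_properC.
by apply: le_pr; [exact: measurableD|exact: measurableC|exact: subIsetr].
Qed.

(** The bound of [hitn_lower] for a finite horizon passes to the limit, since its error term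
    vanishes for [lam < 1]. *)
Lemma pr_visit_lower (B : pred (vertex d)) (g : vertex d -> R) (C s lam : R) :
  0 <= C -> 0 <= s -> 0 <= lam < 1 ->
  (forall x, B x -> g x <= 1) ->
  (forall x, ~~ B x -> g x <= \sum_(m <- moves d) wt p x m * g (mv x m)) ->
  (forall x, ~~ B x -> g x <= C * s ^+ size x) ->
  (forall x : vertex d,
     \sum_(m <- moves d) wt p x m * s ^+ size (mv x m) <= lam * s ^+ size x) ->
  g v <= pr P (proper `&` [set w | exists j, B (X j w)]).
Proof.
move=> C0 s0 /andP[l0 l1] gB gsub gC slam.
have mV : measurable [set w | exists j, B (X j w)].
  rewrite (_ : [set w | _] = \bigcup_(j in [set: nat]) X j @^-1` [set x | B x]).
    by apply: bigcup_measurable => j _; exact: measurable_walk.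
  by apply/seteqP; split => w; [move=> [j ?]; exists j|move=> [j _ ?]; exists j].
rewrite pr_proper_setI//.
have H n : g v - C * s ^+ size v * lam ^+ n <= pr P [set w | exists j, B (X j w)].
  rewrite mulrAC; apply: le_trans (hitn_lower C0 s0 l0 gB gsub gC slam n v) _.
  rewrite -[leLHS]mul1r -pr_start.
  apply: le_trans (pr_visits B (fun=> v) 0 n) _.
  apply: le_pr => //.
    by apply: measurableI; [exact: measurable_cyl|exact: measurable_visits].
  by move=> w [_ [j _ Bj]]; exists j.
have cv : (fun n => g v - C * s ^+ size v * lam ^+ n) @ \oo --> g v - C * s ^+ size v * 0.
  apply: cvgB; first exact: cvg_cst.
  by apply: cvgMr; apply: cvg_expr; rewrite ger0_norm.
rewrite -(subr0 (g v)) -(mulr0 (C * s ^+ size v)) -(cvg_lim _ cv)//.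
apply: limr_le; first exact: cvgP cv.
by apply: nearW.
Qed.

End HittingProbability.

(** * Ancestors as suffixes, and trajectories in the tree *)

Lemma suffix_consE (T : eqType) (z x : seq T) i :
  suffix z (i :: x) = (z == i :: x) || suffix z x.
Proof.
apply/idP/orP => [/suffixP[[|j s] e]|[/eqP->|zx]].
- by left; rewrite e.
- by right; case: e => _ ->; exact: suffix_suffix.
- exact: suffix_refl.
- exact: suffix_trans zx (suffix_cons _ _).
Qed.

(** [catrev c x] is the vertex reached from [x] by descending along [c], read from left to right. *)
Lemma suffix_catrev (T : eqType) (c x : seq T) : suffix x (catrev c x).
Proof. by rewrite catrevE suffix_suffix. Qed.

Lemma size_catrev (T : Type) (c x : seq T) : size (catrev c x) = (size c + size x)%N.
Proof. by rewrite catrevE size_cat size_rev. Qed.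

Lemma catrev_takeS (T : eqType) (c x : seq T) j :
  suffix (catrev (take j c) x) (catrev c x).
Proof.
by rewrite -{2}(cat_take_drop j c) catrev_catl suffix_catrev.
Qed.

Section Trajectories.
Context (d : nat) (g : nat -> vertex d).
Hypothesis legal : forall j, exists m, g j.+1 = mv (g j) m.

(** A subtree can only be entered through its top vertex, by a move downwards: if the parent of a
    vertex lies in the subtree, so does the vertex. *)
Lemma trajectory_enters (z : vertex d) n :
  ~~ suffix z (g 0%N) -> suffix z (g n) -> exists k, g k.+1 = z.
Proof.
move=> z0; elim: n => [|n IHn] zn; first by rewrite zn in z0.
have [/IHn//|zn'] := boolP (suffix z (g n)).
exists n; move: zn; have [m ->] := legal n.
case: m => [i|] /=; first by rewrite suffix_consE (negbTE zn') orbF => /eqP.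
move=> zp; case/negP: zn'; apply: suffix_trans zp _.
by rewrite /parent -drop1 suffix_drop.
Qed.

(** Each vertex of the path strictly below [x] is the top of a subtree that contains the end of the
    path but not [x], so it has to be passed. *)
Lemma trajectory_sweeps (x : vertex d) (c : seq 'I_d) n :
  g 0%N = x -> suffix (catrev c x) (g n) ->
  forall j, (j < size c)%N -> exists k, g k.+1 = catrev (take j.+1 c) x.
Proof.
move=> g0 cn j jc; apply: (@trajectory_enters _ n).
  rewrite g0; apply/negP => /size_suffix; rewrite size_catrev size_takel//; lia.
exact: suffix_trans (catrev_takeS _ _ _) cn.
Qed.

End Trajectories.

(** * Lower bounds for visits from subharmonic functions *)

Section Potential.
Context (R : realType) (d : nat) (p al s lam : R).
Hypothesis d0 : (0 < d)%N.
Hypothesis p01 : 0 <= p <= 1.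
Hypothesis alE : p = al * (1 - p).
Hypothesis al0 : 0 <= al.
Hypothesis al1 : al <= 1.
Hypothesis als : al <= s.
Hypothesis s0 : 0 < s.
Hypothesis s1 : s <= 1.
Hypothesis lam01 : lam < 1.
Hypothesis slam : s <= lam.
Hypothesis pslam : p + (1 - p) * s ^+ 2 <= lam * s.

Lemma up_prob_root : up_prob p (root_vertex d) = 0.
Proof. by rewrite /up_prob eqxx. Qed.

Lemma up_prob_cons i (x : vertex d) : up_prob p (i :: x) = p.
Proof. by []. Qed.

Let dK : d%:R^-1 * d%:R = 1 :> R.
Proof. by rewrite mulVf// dR0. Qed.

Lemma up_probP (x : vertex d) : 0 <= up_prob p x <= 1.
Proof. by rewrite /up_prob; case: eqP => //; rewrite lexx ler01. Qed.

Lemma mean_const (c a : R) : c / d%:R * \sum_(i < d) a = c * a.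
Proof.
by rewrite sumr_const card_ord -(mulr_natl a) mulrA divfK// dR0.
Qed.

(** At the root the walk always descends and [slam] applies; elsewhere [pslam] does. *)
Lemma drift_supersolution (x : vertex d) :
  \sum_(m <- moves d) wt p x m * s ^+ size (mv x m) <= lam * s ^+ size x.
Proof.
rewrite (sum_wt p (fun y => s ^+ size y)) /= mean_const.
case: x => [|i x].
  by rewrite [up_prob _ _]up_prob_root mul0r add0r subr0 mul1r expr1 expr0 mulr1.
rewrite up_prob_cons /= !exprS.
have := exprn_ge0 (size x) (ltW s0); set a := s ^+ size x => a0.
have -> : p * a + (1 - p) * (s * (s * a)) = (p + (1 - p) * s ^+ 2) * a by ring.
have -> : lam * (s * a) = lam * s * a by ring.
by rewrite ler_wpM2r.
Qed.

(* The probability, in the tree extended upwards without end, that the walk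
   started at [x] ever visits [y]: a factor [al] for each step up to the common
   ancestor and a factor [1 / d] for each step down from it. *)
Fixpoint green (y x : vertex d) : R :=
  if x is i :: x' then
    if suffix x y then d%:R^-1 ^+ (size y - size x) else al * green y x'
  else d%:R^-1 ^+ size y.

Lemma green_suffix y x : suffix x y -> green y x = d%:R^-1 ^+ (size y - size x).
Proof. by case: x => [|i x] /=; rewrite ?subn0// => ->. Qed.

Lemma green_ge0 y x : 0 <= green y x.
Proof.
have q0 : 0 <= d%:R^-1 :> R by rewrite invr_ge0.
elim: x => [|i x IHx] /=; first exact: exprn_ge0.
by case: ifP => _; [exact: exprn_ge0|rewrite mulr_ge0//; lra].
Qed.

(** At ancestors of [y], including [y], the left side is at most 1 and the right side at least 1;
    each level away from them costs a factor [al] on the left and [s >= al] on the right. *)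
Lemma green_le y x : green y x <= s ^- size y * s ^+ size x.
Proof.
have q1 : d%:R^-1 <= 1 :> R by rewrite invf_le1 ?ltr0n// ler1n.
have q0 : 0 <= d%:R^-1 :> R by rewrite invr_ge0.
have H (z : vertex d) :
    suffix z y -> d%:R^-1 ^+ (size y - size z) <= s ^- size y * s ^+ size z.
  move=> /size_suffix zy; apply: (@le_trans _ _ 1); first exact: exprn_ile1.
  rewrite ler_pdivlMl ?exprn_gt0// mulr1.
  by apply: ler_wiXn2l => //; exact: ltW.
elim: x => [|i x IHx]; first by have := H [::] (suffix0s _); rewrite subn0.
rewrite /green -/green; case: ifPn => [/H//|_].
rewrite exprS mulrCA; apply: ler_pM => //.
exact: green_ge0.
Qed.

(** By [alE] there is equality at every vertex other than [y] and the root. At the root the walk is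
    forced downwards, which can only increase the mean. *)
Lemma green_subharmonic y x : y != x ->
  green y x <= \sum_(m <- moves d) wt p x m * green y (mv x m).
Proof.
move=> yx; rewrite (sum_wt p (green y)).
set q : R := d%:R^-1; set u := up_prob p x.
have dq : d%:R * q = 1 by rewrite mulrC dK.
have /andP[u0 u1] := up_probP x; rewrite -/u in u0 u1.
have [xy|xy] := boolP (suffix x y); last first.
  case: x @u u0 u1 yx xy => [|i x] u u0 u1 yx xy; first by rewrite suffix0s in xy.
  have E : green y (i :: x) = al * green y x by rewrite /= (negbTE xy).
  rewrite E (eq_bigr (fun=> al * (al * green y x))); last first.
    move=> j _; rewrite /child -E [LHS]/= ifN//; apply: contra xy.
    exact: suffix_trans (suffix_cons _ _).
  rewrite mean_const /u up_prob_cons.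
  have -> : p * green y (parent (i :: x)) = al * (1 - p) * green y x.
    by rewrite -alE.
  have -> : (1 - p) * (al * (al * green y x)) = p * (al * green y x).
    by rewrite [in RHS]alE; ring.
  lra.
move/suffixP: (xy) => [c yE].
(* The last letter [j] of [c] leads from [x] to its child towards [y]. *)
elim/last_ind: c yE => [|c j _] yE; first by rewrite yE eqxx in yx.
rewrite cat_rcons in yE.
have sj : suffix (j :: x) y by rewrite yE suffix_suffix.
have sN i : i != j -> ~~ suffix (child x i) y.
  apply: contra => si; move: sj si; rewrite !suffixE /= => /eqP-> /eqP[ji].
  by rewrite ji.
have k0 : (size y - size x = (size c).+1)%N.
  by rewrite yE size_cat /= addnS subSn ?leq_addl// addnK.
have gx : green y x = q ^+ (size c).+1 by rewrite green_suffix// k0.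
have gj : green y (child x j) = q ^+ size c.
  by rewrite green_suffix// /= subnS k0.
have gi i : i != j -> green y (child x i) = al * q ^+ (size c).+1.
  by move=> /sN ij; rewrite /= (negbTE ij) gx.
rewrite (bigD1 j)// gj (eq_bigr (fun=> al * q ^+ (size c).+1)); last exact: gi.
rewrite sumr_const cardC1 card_ord gx.
have -> : (al * q ^+ (size c).+1) *+ d.-1 = (d%:R - 1) * (al * q ^+ (size c).+1).
  by rewrite -[LHS]mulr_natl -subn1 natrB.
rewrite -/q; set a := q ^+ size c.
have a0 : 0 <= a by rewrite exprn_ge0// invr_ge0.
rewrite exprS -/a.
have q0 : 0 <= q by rewrite invr_ge0.
have q1 : q <= 1 by rewrite invf_le1 ?ltr0n// ler1n.
have -> : (1 - u) * q * (a + (d%:R - 1) * (al * (q * a))) =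
  (1 - u) * q * a * (1 + al * (d%:R * q) - al * q) by ring.
rewrite dq.
have qa0 : 0 <= q * a * (al * (1 - q)).
  by rewrite !mulr_ge0// subr_ge0.
case: x @u u0 u1 yx xy sj sN k0 gx gj gi yE => [|i x] u u0 u1 yx xy sj sN k0 gx gj gi yE.
  by rewrite /u up_prob_root; nra.
have gp : green y (parent (i :: x)) = q * (q * a).
  rewrite green_suffix; last exact: suffix_trans (suffix_cons _ _) xy.
  rewrite /parent /= -exprS -exprS; congr (_ ^+ _).
  by rewrite yE size_cat /= !addnS !subSn ?addnK// ?leq_addl// leqW// leq_addl.
rewrite gp /u up_prob_cons mulr1.
have -> : (1 - p) * q * a * (1 + al - al * q) =
  q * a * ((1 - p) + al * (1 - p) * (1 - q)) by ring.
rewrite -alE; lra.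
Qed.

Context (disp : measure_display) (T : measurableType disp) (P : probability T R).

(** Time 0 is excluded, as in the wake-up rule, where a frog wakes others from its first step on. *)
Definition hits (Y : nat -> T -> vertex d) (y : vertex d) : set T :=
  [set w | exists n, Y n.+1 w = y].

Definition sweeps (Y : nat -> T -> vertex d) (x : vertex d) (c : seq 'I_d) :=
  [set w | forall j, (j < size c)%N ->
    hits Y (catrev (take j.+1 c) x) w].

Lemma process_hits Y y : process_events Y (hits Y y).
Proof.
rewrite (_ : hits Y y = \bigcup_(n in [set: nat]) Y n.+1 @^-1` [set y]).
  by apply: gsigma_bigcup => n _; apply: sub_sigma_algebra; exists n.+1, [set y].
by apply/seteqP; split => w; [move=> [n e]; exists n|move=> [n _ e]; exists n].
Qed.

Lemma process_sweeps Y x c : process_events Y (sweeps Y x c).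
Proof.
rewrite (_ : sweeps Y x c = \bigcap_(j in [set j | (j < size c)%N])
  hits Y (catrev (take j.+1 c) x)); last by apply/seteqP; split.
by apply: gsigma_bigcap => j _; exact: process_hits.
Qed.

Context (v : vertex d) (Y : nat -> T -> vertex d).
Hypothesis bY : biased_walk p P v Y.

Let measurable_event B : process_events Y B -> measurable B.
Proof.
apply: smallest_sub; first exact: sigma_algebra_measurable.
by move=> _ [n [A ->]]; exact: (measurable_walk bY).
Qed.

Let measurable_visit (B : pred (vertex d)) :
  measurable (proper v Y `&` [set w | exists j, B (Y j w)]).
Proof.
apply: measurableI; first exact: (measurable_proper bY).
apply: measurable_event.
rewrite (_ : [set w | _] = \bigcup_(n in [set: nat]) Y n @^-1` [set x | B x]).
  by apply: gsigma_bigcup => n _; apply: sub_sigma_algebra; exists n, [set x | B x].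
by apply/seteqP; split => w; [move=> [n e]; exists n|move=> [n _ e]; exists n].
Qed.

Lemma pr_visit_green y :
  green y v <= pr P (proper v Y `&` [set w | exists j, Y j w == y]).
Proof.
apply: (@pr_visit_lower _ _ _ d0 p01 _ _ P v Y bY (fun x => x == y) (green y)
  (s ^- size y) s lam) => //.
- by rewrite invr_ge0 exprn_ge0// ltW.
- exact: ltW.
- by rewrite lam01 andbT (le_trans _ slam)// ltW.
- by move=> x /eqP->; rewrite green_suffix ?suffix_refl// subnn expr0.
- by move=> x yx; apply: green_subharmonic; rewrite eq_sym.
- by move=> x _; exact: green_le.
- exact: drift_supersolution.
Qed.

Lemma pr_hits_root : v != root_vertex d -> al ^+ size v <= pr P (hits Y (root_vertex d)).
Proof.
move=> v0.
have -> : al ^+ size v = green (root_vertex d) v.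
  rewrite /root_vertex; elim: (v : seq _) => [|i x IHx]; first by rewrite !expr0.
  by rewrite exprS IHx /= suffixs0.
apply: le_trans (pr_visit_green _) _; apply: le_pr.
  exact: (measurable_visit (fun x => x == _)).
  exact: (measurable_event (@process_hits Y _)).
(* A visit at time 0 is impossible because [v] is not the root. *)
move=> w [[Y0 _] [[|n] /eqP e]]; last by exists n.
by move: v0; rewrite -Y0 e eqxx.
Qed.

Lemma proper_sweeps w c n : proper v Y w -> suffix (catrev c v) (Y n w) ->
  sweeps Y v c w.
Proof.
by move=> [Y0 YS] cn j jc; exact: (trajectory_sweeps YS Y0 cn).
Qed.

(** Visiting the end of the path forces a visit to every vertex on the way, so the bound for the end
    alone suffices. *)
Lemma pr_sweeps c : d%:R^-1 ^+ size c <= pr P (sweeps Y v c).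
Proof.
have -> : d%:R^-1 ^+ size c = green (catrev c v) v.
  by rewrite green_suffix ?suffix_catrev// size_catrev addnK.
apply: le_trans (pr_visit_green _) _; apply: le_pr.
  exact: (measurable_visit (fun x => x == _)).
  exact: (measurable_event (@process_sweeps Y _ _)).
move=> w [Yw [n /eqP e]]; apply: (proper_sweeps (n := n) Yw).
by rewrite e suffix_refl.
Qed.

(** The constant 1 is harmonic, and above depth [K] it is at most [s ^- K * s ^+ size x]; hence the
    walk almost surely reaches depth [K]. *)
Lemma pr_sweeps_depth K : v = root_vertex d ->
  1 <= pr P [set w | exists c : K.-tuple 'I_d, sweeps Y v c w].
Proof.
move=> v0.
apply: (@le_trans _ _ (pr P (proper v Y `&`
    [set w | exists j, (K <= size (Y j w))%N]))).
  apply: (@pr_visit_lower _ _ _ d0 p01 _ _ P v Y bY (fun x => (K <= size x)%N)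
    (fun=> 1) (s ^- K) s lam) => //.
  - by rewrite invr_ge0 exprn_ge0// ltW.
  - exact: ltW.
  - by rewrite lam01 andbT (le_trans _ slam)// ltW.
  - by move=> x _; under eq_bigr do rewrite mulr1; rewrite sum_wt1.
  - move=> x; rewrite -ltnNge => /ltnW xK.
    rewrite ler_pdivlMl ?exprn_gt0// mulr1.
    by apply: ler_wiXn2l => //; exact: ltW.
  - exact: drift_supersolution.
apply: le_pr; first exact: (measurable_visit (fun x => (K <= size x)%N)).
  rewrite (_ : [set w | _] = \bigcup_(c in [set: K.-tuple 'I_d]) sweeps Y v c).
    apply: measurable_event; apply: gsigma_bigcup => c _; exact: process_sweeps.
  by apply/seteqP; split => w; [move=> [c ?]; exists c|move=> [c _ ?]; exists c].
move=> w [Yw [n Kn]].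
(* The path from the root to the ancestor of [Y n w] at depth [K], read downwards. *)
pose c := rev (drop (size (Y n w) - K) (Y n w)).
have sc : size c == K by rewrite size_rev size_drop subKn.
exists (Tuple sc); apply: (proper_sweeps (n := n) Yw).
by rewrite v0 catrevE /= cats0 revK suffix_drop.
Qed.

End Potential.

(** * Awakening *)

Section Awakening.
Context (d : nat) (X : vertex d -> nat -> vertex d).

Definition awakens (v : vertex d) : Prop := exists t n, steps X t v = Some n.

Lemma steps_addn t k v n : steps X t v = Some n -> steps X (t + k) v = Some (n + k)%N.
Proof.
move=> tn; elim: k => [|k IHk]; first by rewrite !addn0.
by rewrite !addnS /= IHk.
Qed.

Lemma steps_start t v n : steps X t v = Some n -> exists t0, steps X t0 v = Some 0%N.
Proof.
elim: t n => [|t IHt] n /=; first by case: eqP => // v0 _; exists 0%N; rewrite /= v0 eqxx.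
case E: (steps X t v) => [m|]; first by move=> _; exact: IHt E.
case: asboolP => // h _; exists t.+1; rewrite /= E.
by case: asboolP.
Qed.

(** An awake frog moves at every time step, so it attains every number of steps. *)
Lemma awakens_at v n : awakens v -> exists t, steps X t v = Some n.
Proof.
by move=> [t [m /steps_start[t0 /(steps_addn n) e]]]; exists (t0 + n)%N; rewrite e add0n.
Qed.

Lemma awakens_root : awakens (root_vertex d).
Proof. by exists 0%N, 0%N. Qed.

Lemma awakens_hit u v n : awakens u -> X u n.+1 = v -> awakens v.
Proof.
move=> /(awakens_at n)[t tn] uv.
exists t.+1; case E: (steps X t v) => [m|].
  by exists m.+1; rewrite /= E.
exists 0%N; rewrite /= E; case: asboolP => // h; case: h.
by exists u, n.
Qed.

(** Finitely many visits would involve only frogs from a bounded depth. *)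
Lemma num_root_visits_infinite (R : realType) :
  (forall N, exists u, [/\ (N <= size u)%N, awakens u &
     exists n, X u n.+1 = root_vertex d]) ->
  num_root_visits X R = +oo%E.
Proof.
move=> H; rewrite /num_root_visits /counting asboolF// => fin.
pose N := (\max_(x <- fset_set (root_visits X)) size x.2)%N.
have [u [Nu au [n un]]] := H N.+1.
have [t tn] := awakens_at n.+1 au.
have tu : (t, u) \in fset_set (root_visits X).
  by rewrite in_fset_set// inE; exists n.+1.
have : (size u <= N)%N by apply: (@leq_bigmax_seq _ _ _ (fun x : nat * vertex d => size x.2) (t, u)).
lia.
Qed.

End Awakening.

(** * Chains of frogs along a path *)

Section CrossingBound.
Context (R : realType).

(* Lower bound for the probability that a chain of frogs placed at the sites
   0, ..., k-1 of a half-line reaches site k, when a frog reaches distance t with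
   probability q ^ t and the sites before [a] are already awake. *)
Fixpoint psi (q : R) (k a : nat) : R :=
  match k, a with
  | _, 0 => 0
  | 0, _ => 1
  | k'.+1, a'.+1 => psi q k' a' +
      \sum_(a'.+1 <= t < k'.+2) q ^+ t * (psi q k' t - psi q k' t.-1)
  end.

Lemma psi5 (q : R) : psi q 5 1 =
  q ^+ 5 * (16 - 20 * q - 3 * q ^+ 2 + 7 * q ^+ 3 + 4 * q ^+ 5 - 2 * q ^+ 6
    - q ^+ 8 - q ^+ 9 + q ^+ 10).
Proof. by rewrite /psi unlock /=; ring. Qed.

(** The least favourable value is [q = 1 / 2], that is [d = 2], where the polynomial factor is about
    6.214. All powers except the tenth are bounded by estimates that are sharp there. *)
Lemma psi5_lower (q : R) : 0 <= q -> q <= 1 / 2 -> 31 / 5 * q ^+ 5 <= psi q 5 1.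
Proof.
move=> q0 q1; rewrite psi5 [leRHS]mulrC ler_wpM2r ?exprn_ge0//.
have q2 : q ^+ 2 <= q / 2 by rewrite expr2; nra.
(* This bound and the next are the tangent lines at [1 / 2]. *)
have q3 : 3 / 4 * q - 1 / 4 <= q ^+ 3.
  rewrite -subr_ge0 (_ : _ - _ = (q - 1 / 2) ^+ 2 * (q + 1)); last by field.
  by rewrite mulr_ge0 ?sqr_ge0//; lra.
have q5 : 5 / 16 * q - 1 / 8 <= q ^+ 5.
  rewrite -subr_ge0 (_ : _ - _ = (q - 1 / 2) ^+ 2 *
    (q ^+ 3 + q ^+ 2 + 3 / 4 * q + 1 / 2)); last by field.
  rewrite mulr_ge0 ?sqr_ge0// !addr_ge0 ?exprn_ge0//; lra.
have q5' : 0 <= q ^+ 5 by rewrite exprn_ge0.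
have b6 : q ^+ 6 <= q ^+ 5 / 2 by rewrite exprS mulrC ler_wpM2l//; lra.
have b8 : q ^+ 8 <= q ^+ 5 / 8.
  rewrite (_ : q ^+ 8 = q ^+ 5 * q ^+ 3); last by ring.
  rewrite ler_wpM2l// (_ : 8^-1 = (1 / 2) ^+ 3); last by field.
  by rewrite lerXn2r// nnegrE; lra.
have b9 : q ^+ 9 <= q ^+ 5 / 16.
  rewrite (_ : q ^+ 9 = q ^+ 5 * q ^+ 4); last by ring.
  rewrite ler_wpM2l// (_ : 16^-1 = (1 / 2) ^+ 4); last by field.
  by rewrite lerXn2r// nnegrE; lra.
have q10 : 0 <= q ^+ 10 by rewrite exprn_ge0.
lra.
Qed.

(** Monotonicity of the recursion for [psi]: after summation by parts, the values are weighted by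
    differences of the nonincreasing sequence [q ^+ t], hence by nonnegative coefficients. *)
Lemma abel_sum_le (q : R) (e f : nat -> R) a k : 0 <= q -> q <= 1 -> (a <= k)%N ->
  (forall t, f t <= e t) ->
  f a + \sum_(a.+1 <= t < k.+1) q ^+ t * (f t - f t.-1) <=
  e a + \sum_(a.+1 <= t < k.+1) q ^+ t * (e t - e t.-1).
Proof.
move=> q0 q1 ak fe.
(* The boundary term of the summation by parts is kept for the induction. *)
suff: q ^+ k * (e k - f k) <=
  e a + \sum_(a.+1 <= t < k.+1) q ^+ t * (e t - e t.-1)
  - (f a + \sum_(a.+1 <= t < k.+1) q ^+ t * (f t - f t.-1)).
  have : 0 <= q ^+ k * (e k - f k) by rewrite mulr_ge0 ?exprn_ge0// subr_ge0.
  lra.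
elim: k ak => [|k IHk].
  rewrite leqn0 => /eqP->; rewrite !big_geq// expr0; lra.
rewrite leq_eqVlt => /predU1P[->|]; last rewrite ltnS => ak.
  rewrite !big_geq// !addr0 ler_piMl ?subr_ge0//; exact: exprn_ile1.
rewrite !(@big_nat_recr _ _ _ k.+1)//=.
have := IHk ak.
set S1 := \sum_(_ <= _ < _) _; set S2 := \sum_(_ <= _ < _) _ => H.
have : q ^+ k.+1 * (e k - f k) <= q ^+ k * (e k - f k).
  rewrite ler_wpM2r ?subr_ge0// exprS ler_piMl// exprn_ge0//.
lra.
Qed.

Context (disp : measure_display) (T : measurableType disp) (P : probability T R).

(** The increments [E t] minus [E t.-1] are disjoint. On each of them [D t] suffices, and it is
    independent of the increment. *)
Lemma pr_staircase (D E : nat -> set T) (q : R) a k :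
  (forall t, measurable (D t)) -> (forall t, measurable (E t)) ->
  (forall t, E t `<=` E t.+1) -> (forall t, (t <= k)%N -> q ^+ t <= pr P (D t)) ->
  (forall t, pr P (D t `&` (E t `\` E t.-1)) = pr P (D t) * pr P (E t `\` E t.-1)) ->
  (a <= k)%N ->
  pr P (E a) + \sum_(a.+1 <= t < k.+1) q ^+ t * (pr P (E t) - pr P (E t.-1)) <=
  pr P (E a `|` \bigcup_(t in [set t | (a < t <= k)%N]) (D t `&` E t)).
Proof.
move=> mD mE EE qD DE ak.
have EP s t : (s <= t)%N -> E s `<=` E t.
  elim: t => [|t IHt]; first by rewrite leqn0 => /eqP->.
  rewrite leq_eqVlt => /predU1P[->//|]; rewrite ltnS => /IHt st.
  exact: subset_trans st (EE t).
have mW k' : measurable (E a `|` \bigcup_(t in [set t | (a < t <= k')%N]) (D t `&` E t)).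
  by apply: measurableU => //; apply: bigcup_measurable => t _; exact: measurableI.
have WE k' : (a <= k')%N ->
    E a `|` \bigcup_(t in [set t | (a < t <= k')%N]) (D t `&` E t) `<=` E k'.
  move=> ak' w [/EP|[t /andP[_ /EP tk] [_ /tk//]]]; exact.
elim: k ak qD => [|k IHk] ak qD.
  move: ak; rewrite leqn0 => /eqP e; rewrite big_geq ?e// addr0 -e.
  by apply: le_pr => //; exact: subsetUl.
move: ak; rewrite leq_eqVlt => /predU1P[e|]; last rewrite ltnS => ak.
  by rewrite big_geq ?e// addr0 -e; apply: le_pr => //; exact: subsetUl.
rewrite (@big_nat_recr _ _ _ k.+1)//= addrA.
apply: (@le_trans _ _ (pr P (E a `|` \bigcup_(t in [set t | (a < t <= k)%N]) (D t `&` E t))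
   + pr P (D k.+1 `&` (E k.+1 `\` E k)))).
  apply: lerD; first by apply: IHk => // t tk; apply: qD; exact: leqW.
  rewrite (DE k.+1) /= pr_setD//.
  rewrite ler_wpM2r ?qD// subr_ge0; exact: le_pr.
rewrite -pr_setU//.
- apply: le_pr => //.
    apply: measurableU => //; apply: measurableI => //; exact: measurableD.
  move=> w [[Ea|[t /andP[at_ tk] DEt]]|[Dk [Ek _]]]; first by left.
    by right; exists t => //=; lia.
  by right; exists k.+1 => //=; lia.
- apply: measurableI => //; exact: measurableD.
- by apply/seteqP; split => // w [/(WE _ ak) Ek [_ [_ /(_ Ek)]]].
Qed.

End CrossingBound.

(** * Crossing events and their probabilities *)

Section Crossing.
Context (R : realType) (d : nat) (disp : measure_display)
        (T : measurableType disp) (P : probability T R)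
        (X : vertex d -> nat -> T -> vertex d).

(* The frogs initially on the path leading from [x] down along [b] wake up one
   another and reach the end of the path, given that the first [a] vertices of
   the path are awake. *)
Fixpoint crossing (x : vertex d) (b : seq 'I_d) (a : nat) : set T :=
  match b, a with
  | _, 0 => set0
  | [::], _ => setT
  | i :: b', a'.+1 => crossing (child x i) b' a' `|`
      \bigcup_(t in [set t | (a' < t <= size b)%N])
        (sweeps (X x) x (take t b) `&` crossing (child x i) b' t)
  end.

Lemma crossing_awakens w x b a : crossing x b a w ->
  (forall j, (j < a)%N -> awakens (fun v n => X v n w) (catrev (take j b) x)) ->
  awakens (fun v n => X v n w) (catrev b x).
Proof.
elim: b x a => [|i b IHb] x [|a]//=; first by move=> _ /(_ 0%N isT).
move=> [ca|[t /andP[a_t tb] [st ct]]] aw.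
  by apply: IHb ca _ => j ja; exact: (aw j.+1).
have ax : awakens (fun v n => X v n w) x by exact: (aw 0%N).
apply: IHb ct _ => j jt.
have [|n Xn] := st j; first by rewrite size_takel.
rewrite take_takel// in Xn.
exact: (awakens_hit ax Xn).
Qed.

Lemma crossingS x b a : crossing x b a `<=` crossing x b a.+1.
Proof.
elim: b x a => [|i b IHb] x [|a]//= w [ca|[t /andP[a_t tb] [st ct]]].
  by left; exact: IHb.
have [ta|at_] := leqP t a.+1; last by right; exists t => //=; lia.
by left; have -> : a.+1 = t by lia.
Qed.

(** The bound on the depth leaves out the end of the path, which makes a crossing independent of
    what happens in the subtree below that end. *)
Lemma frog_sigma_crossing x b a :
  frog_sigma X [set z | suffix x z && (size z < size x + size b)%N] (crossing x b a).
Proof.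
elim: b x a => [|i b IHb] x [|a] /=; try exact: sigma_algebra0; try exact: gsigma_setT.
have S t : frog_sigma X
    [set z | suffix x z && (size z < size x + (size b).+1)%N] (crossing (i :: x) b t).
  apply: frog_sigmaS (IHb _ _) => z /= /andP[xz zs]; apply/andP; split.
    exact: suffix_trans (suffix_cons _ _) xz.
  by rewrite addnS; rewrite addSn in zs.
apply: gsigma_setU; first exact: S.
apply: gsigma_bigcup => t _; apply: gsigma_setI; last exact: S.
apply: (@frog_sigma_process _ _ _ _ _ x); last exact: process_sweeps.
by rewrite /= suffix_refl; lia.
Qed.

Hypothesis mX : forall v n (A : set (vertex d)), measurable (X v n @^-1` A).
Hypothesis iX : independent_processes P X.
Context (q : R).
Hypothesis q0 : 0 <= q.
Hypothesis q1 : q <= 1.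
Hypothesis sweepX : forall x c, q ^+ size c <= pr P (sweeps (X x) x c).

(** The frog at [x] is independent of the frogs further down. [pr_staircase] applies with [D t] the
    event that it sweeps [t] vertices and [E t] the crossing of the rest from [t] awake vertices. *)
Lemma pr_crossing x b a : psi q (size b) a <= pr P (crossing x b a).
Proof.
elim: b x a => [|i b IHb] x [|a]; try by rewrite /= ?pr_ge0 ?pr_setT.
have mc t : measurable (crossing (i :: x) b t).
  exact: (measurable_frog_sigma mX (@frog_sigma_crossing _ _ _)).
have ms t : measurable (sweeps (X x) x (take t (i :: b))).
  exact: (measurable_process mX (@process_sweeps _ _ _ _ _ _)).
(* If [a] is larger, the sum in [psi] is empty. *)
have [ab|ba] := leqP a (size b).+1; last first.
  rewrite [psi _ _ _]/= big_geq; last exact: leqW.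
  rewrite addr0.
  apply: le_trans (IHb (i :: x) a) _; apply: le_pr => //; last exact: subsetUl.
  exact: (measurable_frog_sigma mX (@frog_sigma_crossing _ _ _)).
apply: le_trans (abel_sum_le q0 q1 ab (IHb (i :: x))) _.
apply: (pr_staircase (D := fun t => sweeps (X x) x (take t (i :: b)))) => //.
- by move=> t; exact: crossingS.
- by move=> t tb; apply: le_trans (sweepX _ _); rewrite size_takel.
- move=> t; apply: (@frog_sigma_indep _ _ _ _ P X mX iX [set x]
    [set z | suffix (i :: x) z && (size z < size (i :: x) + size b)%N]).
  + apply/seteqP; split => // z [/= -> /andP[/size_suffix]]; by rewrite ltnn.
  + apply: (@frog_sigma_process _ _ _ _ _ x) => //; exact: process_sweeps.
  + rewrite setDE; apply: gsigma_setI; first exact: frog_sigma_crossing.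
    apply: gsigma_setC; exact: frog_sigma_crossing.
Qed.

End Crossing.

(** * Estimates for finite families and sequences of events *)

Lemma exprn_unbounded (R : realType) (k a : R) : 1 < k ->
  exists N, forall n, (N <= n)%N -> a <= k ^+ n.
Proof.
move=> k1.
have bern n : n%:R * (k - 1) <= k ^+ n.
  suff: 1 + n%:R * (k - 1) <= k ^+ n by lra.
  elim: n => [|n IHn]; first by rewrite expr0; lra.
  rewrite exprS.
  have n0 : 0 <= n%:R :> R by [].
  have : k * (1 + n%:R * (k - 1)) <= k * k ^+ n by rewrite ler_wpM2l//; lra.
  apply: le_trans.
  have : 0 <= n%:R * (k - 1) ^+ 2 by rewrite mulr_ge0// sqr_ge0.
  rewrite -natr1 expr2; set m := n%:R; nra.
have [N aN] : exists N : nat, a / (k - 1) <= N%:R.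
  exists (Num.bound `|a / (k - 1)|).
  apply: ltW; apply: le_lt_trans (ler_norm _) _.
  exact: archi_boundP.
exists N => n Nn; apply: le_trans (bern n).
rewrite -ler_pdivrMr; last by lra.
by apply: le_trans aN _; rewrite ler_nat.
Qed.

Section EventSequences.
Context (R : realType) (disp : measure_display) (T : measurableType disp)
        (P : probability T R) (I : eqType).

Lemma bigcup_seq_cons (F : I -> set T) (a : I) (r : seq I) :
  \bigcup_(i in [set` a :: r]) F i = F a `|` \bigcup_(i in [set` r]) F i.
Proof.
apply/seteqP; split => w.
  move=> [i /=]; rewrite inE => /predU1P[->|ir]; first by left.
  by right; exists i.
move=> [Fa|[i ir Fi]]; first by exists a => //=; rewrite mem_head.
by exists i => //=; rewrite inE (ir : i \in r) orbT.
Qed.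

Lemma bigcup_seq_nil (F : I -> set T) : \bigcup_(i in [set` ([::] : seq I)]) F i = set0.
Proof. by apply/seteqP; split => // w [i]. Qed.

Lemma measurable_bigcup_seq (F : I -> set T) (r : seq I) :
  (forall i, measurable (F i)) -> measurable (\bigcup_(i in [set` r]) F i).
Proof.
move=> mF; elim: r => [|a r IHr]; first by rewrite bigcup_seq_nil.
by rewrite bigcup_seq_cons; exact: measurableU.
Qed.

Lemma pr_setI_bigcup_seq_le (A : set T) (F : I -> set T) (r : seq I) (e : R) :
  measurable A -> (forall i, measurable (F i)) ->
  (forall i, i \in r -> pr P (A `&` F i) <= e) ->
  pr P (A `&` \bigcup_(i in [set` r]) F i) <= (size r)%:R * e.
Proof.
move=> mA mF; elim: r => [|a r IHr] Fe.
  by rewrite bigcup_seq_nil setI0 pr_set0 mul0r.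
have mU := measurable_bigcup_seq r mF.
rewrite bigcup_seq_cons setIUr /= -natr1 mulrDl mul1r addrC.
apply: le_trans (pr_setU_le P _ _) _; [exact: measurableI|exact: measurableI|].
apply: lerD; first by apply: Fe; rewrite mem_head.
by apply: IHr => i ir; apply: Fe; rewrite inE ir orbT.
Qed.

(* Bonferroni's inequality, with the pair terms bounded by [e * w i]. *)
Lemma pr_bigcup_seq_ge (F : I -> set T) (w : I -> R) (r : seq I) (e : R) :
  uniq r -> 0 <= e -> (forall i, 0 <= w i) -> (forall i, measurable (F i)) ->
  (forall i j, i != j -> pr P (F i `&` F j) <= e * w i) ->
  \sum_(i <- r) pr P (F i) - (size r)%:R * e * \sum_(i <- r) w i <=
  pr P (\bigcup_(i in [set` r]) F i).
Proof.
move=> + e0 w0 mF Fw; elim: r => [_|a r IHr /= /andP[ar ur]].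
  by rewrite bigcup_seq_nil !big_nil pr_set0 mulr0 subr0.
rewrite bigcup_seq_cons !big_cons pr_setUI//; last exact: measurable_bigcup_seq.
have H : pr P (F a `&` \bigcup_(i in [set` r]) F i) <= (size r)%:R * (e * w a).
  apply: pr_setI_bigcup_seq_le => // i ir; apply: Fw.
  by apply: contraNneq ar => ->.
have := IHr ur.
have W0 : 0 <= \sum_(i <- r) w i by apply: sumr_ge0.
rewrite -natr1; set W := \sum_(_ <- _) w _ in W0 *.
have : 0 <= e * w a by rewrite mulr_ge0.
have : 0 <= e * W by rewrite mulr_ge0.
set n := (size r)%:R.
have -> : (n + 1) * e * (w a + W) = n * (e * w a) + n * e * W + e * w a + e * W by ring.
lra.
Qed.

(* The [A i] need not be disjoint: trying them one after the other makes them so. *)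
Lemma pr_failure_le (G : set (set T)) (A M : I -> set T) (delta : R) (r : seq I) Z :
  <<s G >> `<=` measurable ->
  (forall i, <<s G >> (A i)) -> (forall i, measurable (M i)) ->
  (forall i Y, <<s G >> Y -> pr P (Y `&` M i) <= delta * pr P Y) ->
  <<s G >> Z ->
  pr P (Z `&` \bigcup_(i in [set` r]) A i `\`
     \bigcup_(i in [set` r]) (A i `\` M i)) <=
  delta * pr P (Z `&` \bigcup_(i in [set` r]) A i).
Proof.
move=> mG GA mM Mdelta.
have mA i : measurable (A i) by apply: mG; exact: GA.
have mAM i : measurable (A i `\` M i) by exact: measurableD.
elim: r Z => [|a r IHr] Z GZ.
  by rewrite !bigcup_seq_nil setI0 set0D pr_set0 mulr0.
have mZ : measurable Z by exact: mG.
have mU := measurable_bigcup_seq r mA.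
have mUM := measurable_bigcup_seq r mAM.
rewrite !bigcup_seq_cons.
set U := \bigcup_(_ in _) A _ in mU *; set V := \bigcup_(_ in _) _ in mUM *.
have sub : Z `&` (A a `|` U) `\` ((A a `\` M a) `|` V) `<=`
    (Z `&` A a `&` M a) `|` ((Z `&` ~` A a) `&` U `\` V).
  move=> w [[Zw AU] nAV].
  have [Aa|nAa] := pselect (A a w).
    left; split => //; apply: contrapT => nM; apply: nAV; left; split => //.
  right; split; last by move=> Vw; apply: nAV; right.
  by split => //; case: AU.
have GZA : <<s G >> (Z `&` A a) by exact: gsigma_setI.
have GZA' : <<s G >> (Z `&` ~` A a).
  by apply: gsigma_setI => //; exact: gsigma_setC.
have m1 : measurable (Z `&` A a `&` M a).
  by apply: measurableI => //; exact: mG.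
have m2 : measurable ((Z `&` ~` A a) `&` U `\` V).
  by apply: measurableD => //; apply: measurableI => //; exact: mG.
apply: le_trans (le_pr P _ _ sub) _.
- apply: measurableD; last exact: measurableU.
  by apply: measurableI => //; exact: measurableU.
- exact: measurableU.
apply: le_trans (pr_setU_le P m1 m2) _.
apply: le_trans (lerD (Mdelta a _ GZA) (IHr _ GZA')) _.
rewrite -mulrDr -pr_setU.
- rewrite (_ : Z `&` A a `|` Z `&` ~` A a `&` U = Z `&` (A a `|` U))//.
  apply/seteqP; split => w; first by move=> [[Zw Aw]|[[Zw _] Uw]]; split => //; [left|right].
  move=> [Zw AU]; have [Aa|nAa] := pselect (A a w); first by left.
  by right; split => //; case: AU.
- exact: mG.
- by apply: measurableI => //; exact: mG.
- by apply/seteqP; split => // w [[_ Aw] [[_ /(_ Aw)]]].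
Qed.

(** The tail unions decrease to the upper limit, and each has probability at least [c]. *)
Lemma pr_lim_sup_ge (F : (set T)^nat) (c : R) N :
  (forall n, measurable (F n)) -> (forall n, (N <= n)%N -> c <= pr P (F n)) ->
  c <= pr P (lim_sup_set F).
Proof.
move=> mF cF.
have mU k : measurable (\bigcup_(j >= k) F j).
  by apply: bigcup_measurable => j _; exact: mF.
have mL : measurable (lim_sup_set F).
  by apply: bigcap_measurableType => k _; exact: mU.
have cv := lim_sup_set_cvg P F mF.
rewrite -lee_fin -prE// -(cvg_lim _ (cv _))//; last first.
  by rewrite (le_lt_trans (probability_le1 P (mU 0%N)))// ltry.
apply: lime_ge; first by apply: (cvgP _ (cv _)); rewrite (le_lt_trans (probability_le1 P (mU 0%N)))// ltry.
near=> n.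
apply: (@le_trans _ _ (pr P (F (maxn N n)))%:E).
  by rewrite lee_fin cF// leq_maxl.
rewrite -prE//; apply: le_measure; rewrite ?inE//.
by apply: bigcup_sup => /=; exact: leq_maxr.
Unshelve. all: by end_near.
Qed.

End EventSequences.

(** * Relays of frogs *)

(** Hence the subtrees below distinct vertices of one level are disjoint, and their frogs
    independent. *)
Lemma suffix_size_eq (T : eqType) (x y z : seq T) :
  suffix x z -> suffix y z -> size x = size y -> x = y.
Proof.
by rewrite !suffixE => /eqP ex /eqP ey e; rewrite -[LHS]ex -[RHS]ey e.
Qed.

Lemma catrev_tuple_inj (T : eqType) L (x : seq T) :
  injective (fun b : L.-tuple T => catrev b x).
Proof.
move=> b b' /eqP; rewrite !catrevE eqseq_cat ?size_rev ?size_tuple// eqxx andbT.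
by move=> /eqP/(can_inj revK) e; exact: val_inj.
Qed.

Section Blocks.
Context (R : realType) (d : nat) (disp : measure_display)
        (T : measurableType disp) (P : probability T R)
        (X : vertex d -> nat -> T -> vertex d).
Hypothesis mX : forall v n (A : set (vertex d)), measurable (X v n @^-1` A).
Hypothesis iX : independent_processes P X.
Context (L : nat) (al mu ce eps : R).
Hypothesis L0 : (0 < L)%N.
Hypothesis al0 : 0 < al.
Hypothesis al1 : al <= 1.
Hypothesis ce0 : 0 <= ce.
Hypothesis eps0 : 0 < eps.
Hypothesis mual : 1 < mu * al ^+ L.
Hypothesis ce_mu : mu <= (d ^ L)%:R * (ce - (d ^ L)%:R * eps).
Hypothesis crossX : forall x (b : L.-tuple 'I_d), ce <= pr P (crossing X x b 1).
Hypothesis rootX : forall x, x != root_vertex d ->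
  al ^+ size x <= pr P (hits (X x) (root_vertex d)).

Definition subtree (x : vertex d) : set (vertex d) := [set z | suffix x z].

(* Some frog started [n] blocks below [x] hits the root, after having been
   awakened block by block by a frog started at [x]. *)
Fixpoint relay (n : nat) (x : vertex d) : set T :=
  if n is n'.+1 then
    \bigcup_(b in [set` enum {: L.-tuple 'I_d}])
      (crossing X x b 1 `&` relay n' (catrev b x))
  else hits (X x) (root_vertex d).

Lemma frog_sigma_relay n x : frog_sigma X (subtree x) (relay n x).
Proof.
elim: n x => [|n IHn] x /=.
  apply: (@frog_sigma_process _ _ _ _ _ x); last exact: process_hits.
  exact: suffix_refl.
apply: gsigma_bigcup => b _; apply: gsigma_setI.
  by apply: frog_sigmaS (@frog_sigma_crossing _ _ _ _ _ _ _) => z /andP[].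
apply: frog_sigmaS (IHn _) => z; apply: suffix_trans.
exact: suffix_catrev.
Qed.

Lemma measurable_relay n x : measurable (relay n x).
Proof. exact: (measurable_frog_sigma mX (@frog_sigma_relay n x)). Qed.

Lemma measurable_crossing x b a : measurable (crossing X x b a).
Proof. exact: (measurable_frog_sigma mX (@frog_sigma_crossing _ _ _ X x b a)). Qed.

(** The crossing depends on frogs strictly above the end of the block, the relay on frogs from that
    end downwards. *)
Lemma pr_crossing_relay n x (b : L.-tuple 'I_d) :
  pr P (crossing X x b 1 `&` relay n (catrev b x)) =
  pr P (crossing X x b 1) * pr P (relay n (catrev b x)).
Proof.
apply: (frog_sigma_indep mX iX _ (@frog_sigma_crossing _ _ _ X x b 1)
  (@frog_sigma_relay n (catrev b x))).
apply/seteqP; split => // z [/andP[_ zs] /size_suffix].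
by rewrite size_catrev leqNgt addnC zs.
Qed.

Lemma mu_ge1 : 1 <= mu.
Proof.
have : al ^+ L <= 1 by apply: exprn_ile1 => //; exact: ltW.
have : 0 < al ^+ L by rewrite exprn_gt0.
move=> a0 a1; rewrite leNgt; apply/negP => mu1.
have : mu * al ^+ L <= 1 * al ^+ L by rewrite ler_wpM2r// ltW.
by rewrite mul1r; move: mual; lra.
Qed.

(* If one of the next vertices succeeds with probability at least [eps], reaching
   that vertex is enough; otherwise the pair terms in Bonferroni's inequality are
   small compared to the linear ones. *)
Lemma pr_relayS n x (m : R) : 0 <= m ->
  (forall b : L.-tuple 'I_d, m <= pr P (relay n (catrev b x))) ->
  Num.min (ce * eps) (mu * m) <= pr P (relay n.+1 x).
Proof.
move=> m0 mrelay; pose w (b : L.-tuple 'I_d) := pr P (relay n (catrev b x)).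
pose F (b : L.-tuple 'I_d) := crossing X x b 1 `&` relay n (catrev b x).
have mF b : measurable (F b).
  by apply: measurableI; [exact: measurable_crossing|exact: measurable_relay].
rewrite ge_min; have [[b wb]|/forallNP small] := pselect (exists b, eps <= w b).
  apply/orP; left; apply: (@le_trans _ _ (pr P (F b))).
    by rewrite pr_crossing_relay ler_pM// ltW.
  apply: le_pr => //; first exact: (measurable_relay n.+1).
  by apply: (bigcup_sup (i := b)); rewrite /= mem_enum.
apply/orP; right.
have {}small b : w b <= eps.
  by have /negP := small b; rewrite -ltNge => /ltW.
have w0 b : 0 <= w b by exact: pr_ge0.
have pairs b b' : b != b' -> pr P (F b `&` F b') <= eps * w b.
  move=> bb'; apply: (@le_trans _ _ (pr P
      (relay n (catrev b x) `&` relay n (catrev b' x)))).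
    apply: le_pr; [exact: measurableI|by apply: measurableI; exact: measurable_relay|].
    by move=> z [[_ rb] [_ rb']].
  rewrite (frog_sigma_indep mX iX _ (@frog_sigma_relay n (catrev b x))
    (@frog_sigma_relay n (catrev b' x))).
    by rewrite mulrC; apply: ler_wpM2r; [exact: w0|exact: small].
  apply/seteqP; split => // z [zb zb']; case/eqP: bb'.
  apply: (@catrev_tuple_inj _ _ x); apply: suffix_size_eq zb zb' _.
  by rewrite !size_catrev !size_tuple.
apply: le_trans (pr_bigcup_seq_ge (enum_uniq _) (ltW eps0) w0 mF pairs).
rewrite -cardT card_tuple card_ord.
have : \sum_(b <- enum {: L.-tuple 'I_d}) ce * w b <=
    \sum_(b <- enum {: L.-tuple 'I_d}) pr P (F b).
  by apply: ler_sum => b _; rewrite pr_crossing_relay ler_wpM2r.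
rewrite -mulr_sumr; set S := \sum_(_ <- _) pr _ _; set W := \sum_(_ <- _) _ => SW.
have Wm : (d ^ L)%:R * m <= W.
  rewrite (_ : _ * m = \sum_(b <- enum {: L.-tuple 'I_d}) m).
    by apply: ler_sum => b _; exact: mrelay.
  by rewrite big_enum sumr_const card_tuple card_ord mulr_natl.
have cm := ce_mu; set D : R := (d ^ L)%:R in cm Wm *.
have D0 : 0 <= D by [].
have cD : 0 <= ce - D * eps.
  rewrite leNgt; apply/negP => neg.
  have := mu_ge1; have : D * (ce - D * eps) <= 0 by rewrite mulr_ge0_le0// ltW.
  lra.
apply: (@le_trans _ _ ((ce - D * eps) * W)); last by rewrite mulrBl -/D; lra.
apply: (@le_trans _ _ ((ce - D * eps) * (D * m))); last by rewrite ler_wpM2l.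
by rewrite mulrA (mulrC _ D) ler_wpM2r.
Qed.

(** Each further block gains a factor [mu] from branching and loses [al ^+ L] through the longer
    climb to the root. The net factor exceeds 1, so the bound grows until it saturates at
    [ce * eps], whatever [x] is. *)
Lemma pr_relay_min n x : x != root_vertex d ->
  Num.min (ce * eps) (al ^+ size x * (mu * al ^+ L) ^+ n) <= pr P (relay n x).
Proof.
have ce_eps : 0 <= ce * eps by rewrite mulr_ge0// ltW.
have mu0 : 0 < mu by apply: lt_le_trans ltr01 mu_ge1.
elim: n x => [|n IHn] x x0.
  by rewrite expr0 mulr1 ge_min rootX ?orbT.
pose m := Num.min (ce * eps) (al ^+ (L + size x) * (mu * al ^+ L) ^+ n).
have m0 : 0 <= m.
  by rewrite le_min ce_eps mulr_ge0// exprn_ge0 ?mulr_ge0 ?exprn_ge0// ltW.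
apply: le_trans (pr_relayS (n := n) (x := x) m0 _); last first.
  move=> b; rewrite /m -{1}(size_tuple b) -size_catrev; apply: IHn.
  apply: contra x0 => /eqP e.
  have := size_catrev b x; rewrite e /= size_tuple; lia.
rewrite le_min ge_min lexx /=.
have -> : al ^+ size x * (mu * al ^+ L) ^+ n.+1 =
  mu * (al ^+ (L + size x) * (mu * al ^+ L) ^+ n) by rewrite exprS exprD; ring.
rewrite /m minr_pMr; last exact: ltW.
rewrite le_min !ge_min lexx orbT andbT; apply/orP; left.
by rewrite ler_peMl// mu_ge1.
Qed.

Lemma pr_relay_eventually x : x != root_vertex d ->
  exists N, forall n, (N <= n)%N -> ce * eps <= pr P (relay n x).
Proof.
move=> x0; have [N HN] := exprn_unbounded (ce * eps / al ^+ size x) mual.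
exists N => n Nn; apply: le_trans (pr_relay_min n x0).
rewrite le_min lexx /= [leRHS]mulrC -ler_pdivrMr ?exprn_gt0//; exact: HN.
Qed.

Definition relays (x : vertex d) : set T := lim_sup_set (relay ^~ x).

Lemma pr_relays x : x != root_vertex d -> ce * eps <= pr P (relays x).
Proof.
move=> x0; have [N HN] := pr_relay_eventually x0.
apply: pr_lim_sup_ge HN => n; exact: measurable_relay.
Qed.

Lemma frog_sigma_relays x : frog_sigma X (subtree x) (relays x).
Proof.
apply: gsigma_bigcap => n _; apply: gsigma_bigcup => j _.
exact: frog_sigma_relay.
Qed.

Lemma relay_awakens w n x : relay n x w -> awakens (fun v n => X v n w) x ->
  exists u, [/\ size u = (n * L + size x)%N, awakens (fun v n => X v n w) u &
    exists k, X u k.+1 w = root_vertex d].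
Proof.
elim: n x => [|n IHn] x /=; first by move=> [k Xk] ax; exists x; split => //; exists k.
move=> [b _ [cb rb]] ax.
have [|u [su au hu]] := IHn _ rb.
  by apply: crossing_awakens cb _ => -[|//] _; rewrite take0.
exists u; split => //; rewrite su size_catrev size_tuple; lia.
Qed.

(** Since [L] is positive, relays of unboundedly many blocks end at frogs of unbounded depth. *)
Lemma relays_infinite w x : relays x w -> awakens (fun v n => X v n w) x ->
  num_root_visits (fun v n => X v n w) R = +oo%E.
Proof.
move=> rx ax; apply: num_root_visits_infinite => N.
have [n /= Nn rn] := rx N Logic.I.
have [u [su au hu]] := relay_awakens rn ax.
exists u; split => //; rewrite su; nia.
Qed.

(** * Repeated attempts along a path *)

Context (q : R) (sib : 'I_d -> 'I_d).
Hypothesis sibP : forall i, sib i != i.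
Hypothesis q0 : 0 <= q.
Hypothesis stepX : forall x i, q <= pr P (hits (X x) (child x i)).

(* Along the path leading from [x] down along [c], no frog of the path starts
   infinitely many relays in the subtree next to the path. *)
Fixpoint misses (x : vertex d) (c : seq 'I_d) : set T :=
  if c is i :: c' then
    ~` (hits (X x) (child x (sib i)) `&` relays (child x (sib i)))
      `&` misses (child x i) c'
  else setT.

Lemma frog_sigma_branch x i :
  frog_sigma X [set z | z = x \/ suffix (child x i) z]
    (hits (X x) (child x i) `&` relays (child x i)).
Proof.
apply: gsigma_setI.
  by apply: (@frog_sigma_process _ _ _ _ _ x); [left|exact: process_hits].
by apply: frog_sigmaS (@frog_sigma_relays _) => z ?; right.
Qed.

Lemma frog_sigma_misses x c : frog_sigma X (subtree x) (misses x c).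
Proof.
elim: c x => [|i c IHc] x; first exact: gsigma_setT.
apply: gsigma_setI.
  apply: gsigma_setC; apply: frog_sigmaS (@frog_sigma_branch _ _) => z [->|].
    exact: suffix_refl.
  by apply: suffix_trans; exact: suffix_cons.
by apply: frog_sigmaS (IHc _) => z; apply: suffix_trans; exact: suffix_cons.
Qed.

Lemma measurable_misses x c : measurable (misses x c).
Proof. exact: (measurable_frog_sigma mX (@frog_sigma_misses x c)). Qed.

Lemma pr_branch x i :
  q * (ce * eps) <= pr P (hits (X x) (child x i) `&` relays (child x i)).
Proof.
rewrite (@frog_sigma_indep _ _ _ _ P X mX iX [set x] (subtree (child x i))).
- by apply: ler_pM => //; [rewrite mulr_ge0// ltW|exact: pr_relays].
- by apply/seteqP; split => // z [/= -> /size_suffix]; rewrite ltnn.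
- by apply: (@frog_sigma_process _ _ _ _ _ x) => //; exact: process_hits.
- exact: frog_sigma_relays.
Qed.

(** The attempt at [x] uses the frog at [x] and the subtree of a sibling of the next vertex, the
    later attempts only the subtree of that next vertex. These are disjoint, so the failure
    probabilities multiply. *)
Lemma pr_misses x c : pr P (misses x c) <= (1 - q * (ce * eps)) ^+ size c.
Proof.
elim: c x => [|i c IHc] x /=; first by rewrite pr_setT.
have sB := @frog_sigma_branch x (sib i).
have mB := measurable_frog_sigma mX sB.
have sM := @frog_sigma_misses (child x i) c.
rewrite (frog_sigma_indep mX iX _ (gsigma_setC sB) sM).
  rewrite exprS; apply: ler_pM; [exact: pr_ge0|exact: pr_ge0| |exact: IHc].
  by rewrite pr_setC// lerB// pr_branch.
apply/seteqP; split => // z [[-> /size_suffix|sz cz]]; first by rewrite ltnn.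
have /eqP := suffix_size_eq sz cz erefl; rewrite eqseq_cons eqxx andbT.
by rewrite (negbTE (sibP i)).
Qed.

Lemma misses_awakens w x c : ~ misses x c w ->
  (forall j, (j <= size c)%N -> awakens (fun v n => X v n w) (catrev (take j c) x)) ->
  num_root_visits (fun v n => X v n w) R = +oo%E.
Proof.
elim: c x => [|i c IHc] x /=; first by case.
move=> nm aw; have ax := aw 0%N isT.
have [[[k hk] rk]|nB] := pselect
    ((hits (X x) (child x (sib i)) `&` relays (child x (sib i))) w).
  exact: relays_infinite rk (awakens_hit ax hk).
apply: (IHc (child x i)) => [mc|j jc]; first by apply: nm.
exact: (aw j.+1).
Qed.

Hypothesis depthX : forall K,
  1 <= pr P [set w | exists c : K.-tuple 'I_d,
    sweeps (X (root_vertex d)) (root_vertex d) c w].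
Hypothesis q_ce_eps : 0 < q * (ce * eps).

(** The path is chosen by the root frog and the attempts use other frogs only. Hence, although the
    path is random, all attempts along it fail with probability at most [dl ^+ K]. *)
Lemma root_visits_ae : {ae P, forall w, num_root_visits (fun v n => X v n w) R = +oo%E}.
Proof.
pose dl : R := 1 - q * (ce * eps).
pose A K (c : K.+1.-tuple 'I_d) := sweeps (X (root_vertex d)) (root_vertex d) c.
(* The first vertex is dropped because the root frog already determines the path; [K.+1] letters
   therefore give [K] attempts. *)
pose M K (c : K.+1.-tuple 'I_d) := misses [:: thead c] (behead c).
(* The whole space stands for the [Z] of [pr_failure_le]. *)
pose bad K := setT `&` \bigcup_(c in [set` enum {: K.+1.-tuple 'I_d}]) A K c `\`
  \bigcup_(c in [set` enum {: K.+1.-tuple 'I_d}]) (A K c `\` M K c).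
have sA K c : frog_sigma X [set root_vertex d] (A K c).
  apply: (@frog_sigma_process _ _ _ _ _ (root_vertex d)) => //.
  exact: process_sweeps.
have mS : frog_sigma X [set root_vertex d] `<=` measurable.
  by move=> B; exact: measurable_frog_sigma.
have mA K c : measurable (A K c) by apply: mS; exact: sA.
have mM K c : measurable (M K c) by exact: measurable_misses.
have mUA K : measurable (\bigcup_(c in [set` enum {: K.+1.-tuple 'I_d}]) A K c).
  by apply: measurable_bigcup_seq => c; exact: mA.
have mUAM K : measurable (\bigcup_(c in [set` enum {: K.+1.-tuple 'I_d}])
    (A K c `\` M K c)).
  by apply: measurable_bigcup_seq => c; exact: measurableD.
have UA1 K : pr P (\bigcup_(c in [set` enum {: K.+1.-tuple 'I_d}]) A K c) = 1.
  apply/eqP; rewrite eq_le (pr_le1 P (mUA K)) /=.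
  have := depthX K.+1.
  rewrite (_ : [set w | _] = \bigcup_(c in [set` enum {: K.+1.-tuple 'I_d}]) A K c)//.
  apply/seteqP; split => w; first by move=> [c ?]; exists c => //=; rewrite mem_enum.
  by move=> [c _ ?]; exists c.
have pbad K : pr P (bad K) <= dl ^+ K.
  have MY c Y : frog_sigma X [set root_vertex d] Y ->
      pr P (Y `&` M K c) <= dl ^+ K * pr P Y.
    move=> sY; have sM := @frog_sigma_misses [:: thead c] (behead c).
    rewrite (frog_sigma_indep mX iX _ sY sM).
      rewrite mulrC ler_wpM2r ?pr_ge0//; apply: le_trans (pr_misses _ _) _.
      by rewrite size_behead size_tuple.
    by apply/seteqP; split => // z [/= -> /size_suffix].
  have := pr_failure_le (enum {: K.+1.-tuple 'I_d}) mS (@sA K) (mM K) MY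
    (@gsigma_setT _ _).
  by rewrite /bad setTI UA1 mulr1.
pose good K := \bigcup_(c in [set` enum {: K.+1.-tuple 'I_d}]) (A K c `\` M K c).
have pgood K : 1 - dl ^+ K <= pr P (good K).
  have := pbad K; rewrite /bad setTI.
  have : good K `<=` \bigcup_(c in [set` enum {: K.+1.-tuple 'I_d}]) A K c.
    by move=> w [c cE [Ac _]]; exists c.
  move=> sub; rewrite pr_setD// UA1; lra.
have goodP K w : good K w -> num_root_visits (fun v n => X v n w) R = +oo%E.
  move=> [c _ [Ac nMc]]; apply: (misses_awakens nMc) => j jc.
  have [|k hk] := Ac j; first by move: jc; rewrite size_behead !size_tuple.
  apply: (awakens_hit (n := k) (awakens_root _)); rewrite hk.
  by rewrite [c in LHS]tuple_eta.
have mgood K : measurable (good K) by exact: mUAM.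
pose N := \bigcap_(K in [set: nat]) ~` good K.
have mN : measurable N.
  by apply: bigcap_measurableType => K _; exact: measurableC.
exists N; split => //; last first.
  by move=> w nw K _ gw; apply: nw; exact: goodP gw.
have NK K : pr P N <= dl ^+ K.
  apply: (@le_trans _ _ (pr P (~` good K))).
    by apply: le_pr => //; [exact: measurableC|move=> w; exact].
  by rewrite pr_setC//; have := pgood K; lra.
(* Nonnegativity of [dl] follows from the bound at [K = 1]. *)
have dl0 : 0 <= dl by rewrite -(expr1 dl); exact: le_trans (pr_ge0 P N) (NK 1%N).
have dl1 : dl < 1 by rewrite /dl ltrBlDr ltrDl.
rewrite (prE P mN); congr EFin; apply/eqP; rewrite eq_le (pr_ge0 P) andbT.
have cv : (fun n => dl ^+ n) @ \oo --> (0 : R).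
  by apply: cvg_expr; rewrite ger0_norm.
rewrite -(cvg_lim _ cv)//; apply: limr_ge; first exact: cvgP cv.
by apply: nearW.
Qed.

End Blocks.

(** * Recurrence *)

Lemma exists_neq_ord (d : nat) : (2 <= d)%N -> forall i : 'I_d, exists j, j != i.
Proof.
case: d => [|[|d]] // _ i.
have [->|i0] := eqVneq i ord0; first by exists ord_max.
by exists ord0; rewrite eq_sym.
Qed.

(* [4 / 5] and [99 / 100] are the [s] and [lam] of the error term in
   [hitn_lower]. *)
Lemma frog_recurrent_7_17 (R : realType) (d : nat) : (2 <= d)%N ->
  frog_recurrent d (7 / 17 : R).
Proof.
move=> d2 disp T P X [bX iX].
have d0 : (0 < d)%N by exact: ltnW.
have mX v n (A : set (vertex d)) : measurable (X v n @^-1` A).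
  exact: (measurable_walk (bX v)).
have p01 : 0 <= (7 / 17 : R) <= 1 by apply/andP; split; lra.
have alE : 7 / 17 = 7 / 10 * (1 - 7 / 17) :> R by lra.
have al0 : 0 <= 7 / 10 :> R by lra.
have als : 7 / 10 <= 4 / 5 :> R by lra.
have s0 : 0 < 4 / 5 :> R by lra.
have s1 : 4 / 5 <= 1 :> R by lra.
have lam1 : 99 / 100 < 1 :> R by lra.
have slam : 4 / 5 <= 99 / 100 :> R by lra.
have pslam : 7 / 17 + (1 - 7 / 17) * (4 / 5) ^+ 2 <= 99 / 100 * (4 / 5) :> R.
  by rewrite expr2; lra.
have sweepX x c := pr_sweeps d0 p01 alE al0 als s0 s1 lam1 slam pslam (bX x) c.
have rootX x := pr_hits_root d0 p01 alE al0 als s0 s1 lam1 slam pslam (bX x).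
have depthX K := pr_sweeps_depth d0 p01 s0 s1 lam1 slam pslam (bX (root_vertex d)) K erefl.
set q : R := d%:R^-1.
have q0 : 0 < q by rewrite invr_gt0 ltr0n.
have qh : q <= 1 / 2.
  by rewrite div1r lef_pV2 ?posrE ?ltr0n// ler_nat.
have q1 : q <= 1 by lra.
have [sib sibP] := choice (exists_neq_ord d2).
have stepX x i : q <= pr P (hits (X x) (child x i)).
  rewrite -(expr1 q); apply: le_trans (sweepX x [:: i]) _; apply: le_pr.
  - exact: (measurable_process mX (@process_sweeps _ _ _ _ _ _)).
  - exact: (measurable_process mX (@process_hits _ _ _ _ _)).
  - by move=> w /(_ 0%N isT).
have crossX x (b : 5.-tuple 'I_d) : 31 / 5 * q ^+ 5 <= pr P (crossing X x b 1).
  apply: le_trans (psi5_lower (ltW q0) qh) _.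
  by have := pr_crossing mX iX (ltW q0) q1 sweepX x b 1; rewrite size_tuple.
have Dq : (d ^ 5)%:R * q ^+ 5 = 1 :> R.
  by rewrite natrX -exprMn mulfV ?expr1n// pnatr_eq0 -lt0n.
have qq0 : 0 < q ^+ 5 by rewrite exprn_gt0.
have ce0 : 0 < 31 / 5 * q ^+ 5 by rewrite mulr_gt0//; lra.
(* With this choice the correction [(d ^ 5) ^ 2 * eps] equals [1 / 5], which leaves
   [31 / 5 - 1 / 5 = 6] for [mu]. *)
pose eps := q ^+ 5 * q ^+ 5 / 5.
have eps0 : 0 < eps by rewrite !mulr_gt0// invr_gt0; lra.
have mual : 1 < 6 * (7 / 10) ^+ 5 :> R by rewrite !exprS expr0; lra.
have ce_mu : 6 <= (d ^ 5)%:R * (31 / 5 * q ^+ 5 - (d ^ 5)%:R * eps).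
  rewrite (_ : _ * _ = 31 / 5 * ((d ^ 5)%:R * q ^+ 5)
    - ((d ^ 5)%:R * q ^+ 5) ^+ 2 / 5); last by rewrite /eps; ring.
  by rewrite Dq expr1n; lra.
apply: (root_visits_ae mX iX _ _ _ (ltW ce0) eps0 mual ce_mu crossX rootX sibP
  (ltW q0) stepX depthX).
- by [].
- lra.
- lra.
- exact: mulr_gt0 q0 (mulr_gt0 ce0 eps0).
Qed.

Theorem theorem1 (R : realType) (d : nat) (hd : (2 <= d)%N) :
  (critical_drift R d <= (4155 / 10 ^+ 4)%:E)%E.
Proof.
(* [7 / 17] is about 0.4118. *)
apply: (@le_trans _ _ (7 / 17)%:E).
  apply: ereal_inf_lbound; exists (7 / 17) => //; split.
    by apply/andP; split; lra.
  exact: frog_recurrent_7_17.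
rewrite lee_fin !exprS expr0; lra.
Qed.
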